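(* Let $\mathbb{F}$ be a field of characteristic zero. There exist a polynomial function $q$ and an absolute constant $c$ such that the following hold for every $n$-variate polynomial $f \in \mathbb{F}[x_1,\dots,x_n]$ of degree $d$ and every polynomial $g \in \mathbb{F}[x_1,\dots,x_n]$ dividing $f$: (1) If $f$ can be computed by an algebraic circuit over $\mathbb{F}$ of size $s$ and depth $\Delta$, then $g$ can be computed by an algebraic circuit over $\mathbb{F}$ of size at most $q(s,d,n)$ and depth at most $\Delta + c$. (2) If $f$ can be computed by an algebraic formula over $\mathbb{F}$ of size $s$, then $g$ can be computed by an algebraic formula over $\mathbb{F}$ of size at most $q(s,d,n)$.
   Context: An algebraic circuit over $\mathbb{F}$ is a directed acyclic graph whose leaves are labelled by variables or field constants, whose internal gates are labelled $+$ or $\times$, and whose edges may carry field constants (scalars); it computes a polynomial at its output gate. Its size is the number of wires (edges) and its depth is the length of the longest path from the output to a leaf. An algebraic formula is an algebraic circuit whose underlying graph is a tree (every gate has fan-out at most one). *)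

(* Defs.v *)
From HB Require Import structures.
From mathcomp Require Import all_boot all_order all_algebra.
From mathcomp Require Import mpoly.
Set Implicit Arguments. Unset Strict Implicit. Unset Printing Implicit Defensive.
Import Order.TTheory GRing.Theory Num.Theory.
Local Open Scope ring_scope.

(* ---------- Algebraic circuits (as straight-line programs) ----------
   A circuit is a nonempty list of gates; gate number k may only read gates
   with index < k (so the underlying graph is a DAG).  A gate is a leaf
   (a variable or a field constant) or an internal +/x gate of unbounded
   fan-in; every incoming wire (an index of an earlier gate) carries a field
   scalar.  The output gate is the last gate. *)
Section Circuits.
Variables (F : fieldType) (n : nat).

Inductive gate :=
  | GVar of 'I_n
  | GConst of F
  | GAdd of seq (F * nat)
  | GMul of seq (F * nat).

Definition circuit := seq gate.

Definition gate_inputs (g : gate) : seq (F * nat) :=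
  match g with GAdd l | GMul l => l | _ => [::] end.

Definition gate_wf (k : nat) (g : gate) : bool :=
  match g with
  | GVar _ | GConst _ => true
  | GAdd l | GMul l => (l != [::]) && all (fun p => p.2 < k)%N l
  end.

Definition circuit_wf (C : circuit) : bool :=
  (0 < size C)%N && all (fun kg => gate_wf kg.1 kg.2) (zip (iota 0 (size C)) C).

Definition eval_gate (vals : seq {mpoly F[n]}) (g : gate) : {mpoly F[n]} :=
  match g with
  | GVar i => 'X_i
  | GConst c => c%:MP
  | GAdd l => \sum_(p <- l) (p.1 *: nth 0 vals p.2)
  | GMul l => \prod_(p <- l) (p.1 *: nth 0 vals p.2)
  end.

Definition circuit_vals (C : circuit) : seq {mpoly F[n]} :=
  foldl (fun vals g => rcons vals (eval_gate vals g)) [::] C.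

Definition depth_gate (ds : seq nat) (g : gate) : nat :=
  match g with
  | GVar _ | GConst _ => 0%N
  | GAdd l | GMul l => (\max_(p <- l) nth 0%N ds p.2).+1
  end.

Definition circuit_depths (C : circuit) : seq nat :=
  foldl (fun ds g => rcons ds (depth_gate ds g)) [::] C.

Definition circuit_size (C : circuit) : nat :=
  sumn [seq size (gate_inputs g) | g <- C].

Definition circuit_depth (C : circuit) : nat := last 0%N (circuit_depths C).

Definition circuit_output (C : circuit) : {mpoly F[n]} := last 0 (circuit_vals C).

Definition computes_circuit (C : circuit) (f : {mpoly F[n]}) : Prop :=
  circuit_wf C /\ circuit_output C = f.

Inductive formula :=
  | FVar of 'I_n
  | FConst of F
  | FAdd of seq (F * formula)
  | FMul of seq (F * formula).

Fixpoint formula_eval (t : formula) : {mpoly F[n]} :=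
  match t with
  | FVar i => 'X_i
  | FConst c => c%:MP
  | FAdd l => (fix aux (l : seq (F * formula)) :=
                 match l with [::] => 0 | (a, t') :: l' => a *: formula_eval t' + aux l' end) l
  | FMul l => (fix aux (l : seq (F * formula)) :=
                 match l with [::] => 1 | (a, t') :: l' => a *: formula_eval t' * aux l' end) l
  end.

Fixpoint formula_size (t : formula) : nat :=
  match t with
  | FVar _ | FConst _ => 0%N
  | FAdd l | FMul l => (fix aux (l : seq (F * formula)) :=
                 match l with [::] => 0%N | (_, t') :: l' => (formula_size t').+1 + aux l' end)%N l
  end.

End Circuits.

Definition mdivides (F : fieldType) (n : nat) (g f : {mpoly F[n]}) : Prop :=
  exists h : {mpoly F[n]}, f = g * h.

Definition eval3 (q : {mpoly rat[3]}) (s d n : nat) : rat :=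
  q.@[fun i : 'I_3 => (nth 0%N [:: s; d; n] i)%:R].

(* Main.v *)
Require Import Defs.
From HB Require Import structures.
From mathcomp Require Import all_boot all_order all_algebra.
From mathcomp Require Import mpoly.
From mathcomp Require Import qpoly ring zify.
From Stdlib Require Import Classical.
Set Implicit Arguments. Unset Strict Implicit. Unset Printing Implicit Defensive.
Import Order.TTheory GRing.Theory Num.Theory.
Local Open Scope ring_scope.

(* Let [P(t, y)] and [Q(t, y)] be [f] and [g] at [x := y a + b + t (x - b)], where
   [a] is a direction in which the top form of [g] does not vanish; then [g] is
   [Q(1, 0)].  Over the fraction field of [F[x]] write [Q = lc * prod_i v_i] with
   [P = v_i^(e_i) w_i], [v_i] and [w_i] coprime.  For generic [b] this specializes
   to a factorization into power series in [t], and modulo [t^(d+1)]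
     [log (P / P(0)) = e_i log (v_i / v_i(0)) + log (w_i / w_i(0))],
   where the first summand consists of proper fractions in [y] whose denominators
   are powers of [v_i(0)].  Hence [log (v_i / v_i(0))] is a partial fraction
   projection of
     [log (P / P(0)) = sum_m (-1)^m / (m+1) * ((P - P(0)) / P(0))^(m+1)],
   that is, an F-linear function of the y-coefficients of the powers of
   [P - P(0)].  Summing over [i] and exponentiating recovers [Q(t, 0)].  All
   coefficient extractions are interpolations in [y] and [t], so [g] becomes a
   sum of powers of sums of powers of affine substitutions of [f]: a constant
   number of layers on top of polynomially many copies of the circuit of [f].
   Neither unique factorization in [F[x]] nor Hensel lifting is needed, and
   multiplicities only contribute the scalars [e_i]. *)

(** * Polynomials modulo a power of the variable *)


Definition tmod (R : comNzRingType) (N : nat) (p q : {poly R}) : Prop :=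
  exists r, p = q + 'X^N * r.

Lemma coef0_exp (R : comNzRingType) (p : {poly R}) k : (p ^+ k)`_0 = p`_0 ^+ k.
Proof. by elim: k => [|k IH]; rewrite ?expr0 ?coef1 // !exprS coef0M IH. Qed.

Section Tmod.
Variable (R : comNzRingType).
Implicit Types p q r l : {poly R}.

Lemma tmodP N p q : tmod N p q <-> (forall k, (k < N)%N -> p`_k = q`_k).
Proof.
split=> [[r ->] k kN|pq]; first by rewrite coefD coefXnM kN addr0.
exists (drop_poly N (p - q)).
have/(congr1 (fun s => q + s)) := poly_take_drop N (p - q).
rewrite [q + (p - q)]addrC subrK => {1}<-; rewrite mulrC; congr (_ + _).
rewrite [X in X + _](_ : _ = 0) ?add0r //.
apply/polyP=> k; rewrite coef_take_poly coef0; case: ifP => // kN.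
by rewrite coefB pq ?subrr.
Qed.

Lemma tmod_refl N p : tmod N p p.
Proof. by exists 0; rewrite mulr0 addr0. Qed.

Lemma tmod_sym N p q : tmod N p q -> tmod N q p.
Proof. by move=> /tmodP pq; apply/tmodP=> k kN; rewrite pq. Qed.

Lemma tmod_trans N q p r : tmod N p q -> tmod N q r -> tmod N p r.
Proof. by move=> /tmodP pq /tmodP qr; apply/tmodP=> k kN; rewrite pq ?qr. Qed.

Lemma tmodW N M p q : (M <= N)%N -> tmod N p q -> tmod M p q.
Proof.
by move=> MN /tmodP pq; apply/tmodP=> k kN; apply: pq; apply: leq_trans MN.
Qed.

Lemma tmodM N p q p' q' : tmod N p q -> tmod N p' q' -> tmod N (p * p') (q * q').
Proof.
by move=> [r ->] [s ->]; exists (r * q' + q * s + r * 'X^N * s); ring.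
Qed.

Lemma tmodMl N r p q : tmod N p q -> tmod N (r * p) (r * q).
Proof. by move=> pq; apply: tmodM => //; apply: tmod_refl. Qed.

Lemma tmodMr N r p q : tmod N p q -> tmod N (p * r) (q * r).
Proof. by move=> pq; apply: tmodM => //; apply: tmod_refl. Qed.

Lemma tmodX N p q e : tmod N p q -> tmod N (p ^+ e) (q ^+ e).
Proof.
move=> pq; elim: e => [|e IH]; first by rewrite !expr0; apply: tmod_refl.
by rewrite !exprS; apply: tmodM.
Qed.

Lemma tmod_subr0 N p q : tmod N (p - q) 0 <-> tmod N p q.
Proof.
split=> /tmodP pq; apply/tmodP=> k kN; last by rewrite coefB coef0 pq ?subrr.
by apply/eqP; rewrite -subr_eq0 -coefB pq ?coef0.
Qed.

Lemma tmod_deriv N p q : tmod N.+1 p q -> tmod N p^`() q^`().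
Proof. by move=> /tmodP pq; apply/tmodP=> k kN; rewrite !coef_deriv pq. Qed.

Lemma coef0_mulX p : p`_0 = 0 -> exists q, p = 'X * q.
Proof.
move=> p0; have/tmodP[q ->] : forall k, (k < 1)%N -> p`_k = (0 : {poly R})`_k.
  by case=> // _; rewrite p0 coef0.
by exists q; rewrite add0r expr1.
Qed.

Lemma tmod_expr0 N p : p`_0 = 0 -> tmod N (p ^+ N) 0.
Proof. by move=> /coef0_mulX[q ->]; exists (q ^+ N); rewrite exprMn add0r. Qed.

End Tmod.

Section TmodUnit.
Variable (R : comUnitRingType).
Implicit Types p q r l : {poly R}.
Hypothesis natU : forall m, m.+1%:R \is a @GRing.unit R.

(** Geometric series: [p] divided by its constant coefficient is [1 - x] with [x] divisible by the
    variable, so that [x ^+ N] vanishes modulo ['X^N]. *)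
Lemma tmod_inv N p : p`_0 \is a GRing.unit -> exists q, tmod N (p * q) 1.
Proof.
set c := p`_0 => cU; pose x := 1 - c^-1 *: p.
have x0 : x`_0 = 0 by rewrite coefB coef1 coefZ mulVr ?subrr.
exists (c^-1 *: \sum_(i < N) x ^+ i); rewrite -scalerAr scalerAl.
have -> : c^-1 *: p = 1 - x by rewrite /x; ring.
have -> : (1 - x) * (\sum_(i < N) x ^+ i) = 1 - x ^+ N.
  by rewrite -[RHS]opprB subrX1; ring.
by have [r ->] := tmod_expr0 N x0; exists (- r); ring.
Qed.

Lemma tmod_integral N p q :
  p`_0 = q`_0 -> tmod N p^`() q^`() -> tmod N.+1 p q.
Proof.
move=> pq0 /tmodP pq; apply/tmodP => -[|k] kN //.
have := pq k kN; rewrite !coef_deriv -[LHS]mulr_natr -[RHS]mulr_natr.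
exact/mulIr/natU.
Qed.

(** Uniqueness for a linear differential equation with zero initial value: if [p] vanishes to order
    [j], so does its derivative, and integration raises the order of [p] to [j + 1]. *)
Lemma tmod_ode N p l :
  p`_0 = 0 -> tmod N p^`() (l * p) -> tmod N.+1 p 0.
Proof.
move=> p0 dp; suff: forall j, (j <= N.+1)%N -> tmod j p 0 by apply.
elim=> [|j IH] jN; first by apply/tmodP.
apply: tmod_integral; rewrite ?p0 ?coef0 // linear0.
apply: tmod_trans (tmodW _ dp) _ => //.
by rewrite -(mulr0 l); apply: tmodMl; apply: IH; apply: ltnW.
Qed.

(* [p0^N log (p / p0)] truncated at order [N], where [p0] is the constant
   coefficient of [p]. *)
Definition tlog N p : {poly R} :=
  \sum_(m < N) ((-1) ^+ m * m.+1%:R^-1 * p`_0 ^+ (N - m.+1)) *: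
    (p - (p`_0)%:P) ^+ m.+1.

Lemma tlog_coef0 N p : (tlog N p)`_0 = 0.
Proof.
rewrite coef_sum big1 // => m _; rewrite coefZ exprS coef0M.
by rewrite coefB coefC eqxx subrr mul0r mulr0.
Qed.

(** The logarithmic derivative without denominators. Differentiating the series gives [p'] times a
    geometric sum, which telescopes against [p = c - (- d)]; the remainder [(- d) ^+ N] is divisible
    by ['X^N]. *)
Lemma deriv_tlog N p :
  tmod N ((tlog N p)^`() * p) ((p`_0)%:P ^+ N * p^`()).
Proof.
set c := p`_0; set d := p - c%:P.
have -> : (tlog N p)^`() =
    p^`() * \sum_(m < N) c%:P ^+ (N.-1 - m) * (- d) ^+ m.
  rewrite raddf_sum mulr_sumr; apply: eq_bigr => m _ /=.
  rewrite derivZ deriv_exp /= derivB derivC subr0 -scaler_nat !scalerA -/c -/d.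
  rewrite -mul_polyC !polyCM !polyC_exp -subn1 -subnDA add1n.
  rewrite [(- d) ^+ m]exprNn polyCN.
  transitivity (p^`() * (c%:P ^+ (N - m.+1) * ((-1) ^+ m * d ^+ m)) *
    (m.+1%:R^-1 * m.+1%:R)%:P); first by rewrite polyCM; ring.
  by rewrite mulVr ?mulr1.
have -> : p = c%:P - (- d) by rewrite /d; ring.
rewrite -mulrA [_ * (_ - _)]mulrC -subrXX -[X in tmod _ X]mulrC.
have [|r ->] := @tmod_expr0 _ N (- d).
  by rewrite coefN coefB coefC eqxx subrr oppr0.
by exists (- (r * (c%:P - - d)^`())); rewrite opprK /d; ring.
Qed.

Definition texp N p : {poly R} := \sum_(j < N) (j`!)%:R^-1 *: p ^+ j.

Lemma fact_unit j : (j`!)%:R \is a @GRing.unit R.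
Proof. by have := natU (j`!).-1; rewrite prednK ?fact_gt0. Qed.

(** Differentiation loses the last term of the truncated series, a multiple of [p ^+ N]; it is
    divisible by ['X^N] since [p] has no constant term. *)
Lemma deriv_texp N p :
  p`_0 = 0 -> tmod N (texp N.+1 p)^`() (p^`() * texp N.+1 p).
Proof.
move=> p0; rewrite /texp [X in _ * X]big_ord_recr /=.
have -> : (\sum_(j < N.+1) (j`!)%:R^-1 *: p ^+ j)^`() =
  p^`() * \sum_(j < N) (j`!)%:R^-1 *: p ^+ j.
  rewrite raddf_sum mulr_sumr big_ord_recl /= expr0 derivZ derivC scaler0 add0r.
  apply: eq_bigr => j _; rewrite /= derivZ deriv_exp /= /bump add1n /=.
  rewrite -scaler_nat scalerA factS natrM invrM ?natU ?fact_unit //.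
  by rewrite -mulrA mulVr ?mulr1 // -scalerAr.
have [r ->] := tmod_expr0 N p0.
by exists (- (N`!%:R^-1 *: (p^`() * r))); rewrite -!mul_polyC; ring.
Qed.

Lemma texp_coef0 N p : p`_0 = 0 -> (texp N.+1 p)`_0 = 1.
Proof.
move=> p0; rewrite /texp big_ord_recl /= expr0 coefD coefZ coef1 fact0 invr1.
rewrite mulr1 coef_sum big1 ?addr0 // => j _.
by rewrite coefZ exprS coef0M p0 mul0r mulr0.
Qed.

(** [p] and the scaled exponential of [l] solve the same linear equation with the same initial
    value; [tmod_ode] applies to their difference. *)
Lemma tmod_ode_exp N p l :
  l`_0 = 0 -> tmod N p^`() (l^`() * p) -> tmod N.+1 p (p`_0 *: texp N.+1 l).
Proof.
move=> l0 dp; apply/tmod_subr0; apply: (@tmod_ode _ _ l^`()).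
  by rewrite coefB coefZ texp_coef0 // mulr1 subrr.
rewrite derivB derivZ.
have [r ->] := dp; have [s ->] := deriv_texp N l0.
by exists (r - p`_0 *: s); rewrite -!mul_polyC; ring.
Qed.

End TmodUnit.

(** In a domain the constant coefficient of [p] can be cancelled without being a unit: the
    coefficients of [q - r] vanish one order at a time. *)
Lemma tmod_cancel (R : idomainType) N (p q r : {poly R}) :
  p`_0 != 0 -> tmod N (p * q) (p * r) -> tmod N q r.
Proof.
move=> p0 /tmod_subr0 pqr; apply/tmod_subr0; move: pqr; rewrite -mulrBr.
elim: N {q r}(q - r) => [|N IH] q; first by move=> _; apply/tmodP.
move=> pq; have [r qE] := IH q (tmodW (leqnSn N) pq).
rewrite add0r in qE; case: pq => s; rewrite add0r qE mulrCA exprSr -mulrA.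
move/(mulfI (monic_neq0 (monicXn R N))) => prE.
have : (p * r)`_0 = ('X * s : {poly R})`_0 by rewrite prE.
rewrite !coef0M coefX mul0r => /eqP; rewrite mulf_eq0 (negbTE p0) /= => /eqP.
by move=> /coef0_mulX[t rE]; exists t; rewrite rE add0r exprSr mulrA.
Qed.

Lemma tmod_map (R S : comNzRingType) (phi : {rmorphism R -> S}) N (p q : {poly R}) :
  tmod N p q -> tmod N (map_poly phi p) (map_poly phi q).
Proof. by move=> /tmodP pq; apply/tmodP => k kN; rewrite !coef_map pq. Qed.

Lemma tmod_take (R : comNzRingType) N (p : {poly R}) : tmod N (take_poly N p) p.
Proof. by apply/tmodP => k kN; rewrite coef_take_poly kN. Qed.

(** * Logarithms of products, and residues *)


(** The rule [log p = (e+1) log v + log w], multiplied by [p0^M = v0^((e+1)M) w0^M] with [M = N+1].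
    Both sides start at 0, so derivatives are compared; after multiplication by [p] they are given
    by [deriv_tlog]. *)
Lemma tlog_factor (R : idomainType) (N e : nat) (p v w : {poly R}) :
    (forall m, m.+1%:R \is a @GRing.unit R) ->
    p`_0 != 0 -> tmod N.+1 p (v ^+ e.+1 * w) ->
  tmod N.+1 (tlog N.+1 p)
    ((v`_0)%:P ^+ (e * N.+1) * (e.+1%:R * (w`_0)%:P ^+ N.+1 * tlog N.+1 v
                               + (v`_0)%:P ^+ N.+1 * tlog N.+1 w)).
Proof.
move=> natU p0 pE; set M := N.+1 in pE *.
have p0E : (p`_0)%:P = (v`_0)%:P ^+ e.+1 * (w`_0)%:P.
  rewrite (proj1 (tmodP _ _ _) pE) // coef0M polyCM; congr (_ * _).
  by rewrite -polyC_exp coef0_exp.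
set cv := (v`_0)%:P in p0E *; set cw := (w`_0)%:P in p0E *.
apply: tmod_integral => //.
  by rewrite tlog_coef0 coef0M coefD !coef0M !tlog_coef0 !mulr0 addr0 mulr0.
apply: (@tmod_cancel _ _ p) => //.
have := tmodW (leqnSn N) (deriv_tlog natU M p).
rewrite mulrC => /tmod_trans; apply.
apply: tmod_trans (tmodMl _ (tmod_deriv pE)) _; apply: tmod_sym.
apply: tmod_trans (tmodMr _ (tmodW (leqnSn N) pE)) _.
have -> : (cv ^+ (e * M) * (e.+1%:R * cw ^+ M * tlog M v + cv ^+ M * tlog M w))^`()
   = cv ^+ (e * M) * (e.+1%:R * cw ^+ M * (tlog M v)^`() + cv ^+ M * (tlog M w)^`()).
  rewrite /cv /cw -!polyC_exp deriv_mulC derivD deriv_mulC -polyC_natr -polyCM.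
  by rewrite deriv_mulC.
have [r1 E1] := tmodW (leqnSn N) (deriv_tlog natU M v).
have [r2 E2] := tmodW (leqnSn N) (deriv_tlog natU M w).
rewrite -/cv -/cw in E1 E2 *.
exists (cv ^+ (e * M) * (e.+1%:R * cw ^+ M * v ^+ e * w * r1
          + cv ^+ M * v ^+ e.+1 * r2)).
rewrite p0E exprMn -exprM mulSn exprD derivM deriv_exp /= -[X in X * w + _]mulr_natr.
transitivity (cv ^+ (e * M) * (e.+1%:R * cw ^+ M * v ^+ e * w * ((tlog M v)^`() * v)
          + cv ^+ M * v ^+ e.+1 * ((tlog M w)^`() * w))); first by rewrite exprS; ring.
by rewrite E1 E2; ring.
Qed.

Lemma coef_tlog_factor (R : idomainType) (N e k : nat) (p v w : {poly R}) :
    (forall m, m.+1%:R \is a @GRing.unit R) ->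
    p`_0 != 0 -> tmod N.+1 p (v ^+ e.+1 * w) -> (k < N.+1)%N ->
  (tlog N.+1 p)`_k =
    v`_0 ^+ (e * N.+1) * e.+1%:R * (tlog N.+1 v)`_k * w`_0 ^+ N.+1
    + (tlog N.+1 w)`_k * v`_0 ^+ (e.+1 * N.+1).
Proof.
move=> natU p0 pE kN.
rewrite (proj1 (tmodP _ _ _) (tlog_factor natU p0 pE) k kN).
rewrite -!polyC_exp coefCM coefD -polyC_natr -polyCM !coefCM mulSn exprD.
by ring.
Qed.

Section Functional.
Variables (F : fieldType) (A : comNzRingType) (iota : {rmorphism F -> A}).

(** The [A]-linear extension to [A[y]] of the linear form on [F[y]] that sends [y^i] to [l i]. Its
    values lie in [F], so that they can become scalars on wires. *)
Definition lcoef (l : nat -> F) (p : {poly A}) : A :=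
  \sum_(i < size p) p`_i * iota (l i).

Lemma lcoefE l n (p : {poly A}) : (size p <= n)%N ->
  lcoef l p = \sum_(i < n) p`_i * iota (l i).
Proof.
move=> pn; rewrite /lcoef (big_ord_widen n (fun i => p`_i * iota (l i)) pn).
rewrite big_mkcond; apply: eq_bigr => i _; case: ifP => // /negbT.
by rewrite -leqNgt => /(nth_default 0) ->; rewrite mul0r.
Qed.

Lemma lcoef_is_scalable l : scalable_for *%R (lcoef l).
Proof.
move=> c p; rewrite (@lcoefE l (size p)) ?size_scale_leq // mulr_sumr.
by apply: eq_bigr => i _; rewrite coefZ mulrA.
Qed.

Lemma lcoef_is_zmod l : zmod_morphism (lcoef l).
Proof.
move=> p q; pose n := maxn (size p) (size q).
rewrite !(@lcoefE l n) ?leq_maxl ?leq_maxr //; last first.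
  by rewrite (leq_trans (size_polyD _ _)) ?size_polyN.
by rewrite -sumrB; apply: eq_bigr => i _; rewrite coefB mulrBl.
Qed.

HB.instance Definition _ l :=
  GRing.isZmodMorphism.Build {poly A} A (lcoef l) (lcoef_is_zmod l).
HB.instance Definition _ l :=
  GRing.isScalable.Build A {poly A} A *%R (lcoef l) (lcoef_is_scalable l).

Lemma lcoef_map l (p : {poly F}) :
  lcoef l (map_poly iota p) = iota (\sum_(i < size p) p`_i * l i).
Proof.
rewrite (@lcoefE l (size p)) ?size_poly // rmorph_sum.
by apply: eq_bigr => i _; rewrite coef_map rmorphM.
Qed.

Lemma lcoefD l1 l2 p : lcoef (fun i => l1 i + l2 i) p = lcoef l1 p + lcoef l2 p.
Proof.
by rewrite /lcoef -big_split; apply: eq_bigr => i _; rewrite rmorphD mulrDr.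
Qed.

Lemma residue_functional (v w : {poly F}) : v != 0 -> coprimep v w ->
  exists l : nat -> F, forall q : {poly A},
     lcoef l (q * map_poly iota v) = 0 /\
    ((size q < size v)%N -> lcoef l (q * map_poly iota w) = q.[0]).
Proof.
move=> v0 /Bezout_eq1_coprimepP[[s' s] /= bez].
pose l i := ('X^i * s %% v).[0].
have lE (p : {poly F}) : lcoef l (map_poly iota p) = iota ((p * s %% v).[0]).
  rewrite lcoef_map; congr (iota _); rewrite -[in RHS](coefK p) poly_def.
  rewrite mulr_suml (big_morph (fun r => r %% v) (modpD v) (mod0p v)) horner_sum; apply: eq_bigr => i _.
  by rewrite -scalerAl modpZl hornerZ.
have expand (q : {poly A}) n (u : {poly F}) : (size q <= n)%N ->
  lcoef l (q * map_poly iota u) =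
    \sum_(i < n) q`_i * iota (('X^i * u * s %% v).[0]).
  move=> qn; rewrite -{1}(take_poly_id qn) /take_poly poly_def mulr_suml linear_sum.
  apply: eq_bigr => i _; rewrite -scalerAl linearZ /= -lE.
  by rewrite rmorphM /= map_polyXn.
exists l => q; split=> [|qv].
  rewrite (expand q (size q)) // big1 // => i _.
  by rewrite mulrAC modp_mull horner0 rmorph0 mulr0.
rewrite (expand q (size q)) // [in RHS]horner_coef; apply: eq_bigr => i _.
have -> : 'X^i * w * s = 'X^i - 'X^i * s' * v.
  by rewrite -[X in X - _]mulr1 -bez; ring.
rewrite modpD modpN modp_mull subr0 modp_small ?hornerXn ?rmorphXn ?rmorph0 //.
by rewrite size_polyXn (leq_ltn_trans (ltn_ord i) qv).
Qed.

End Functional.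

(** * Projection onto one factor *)


Lemma pchar0_natU (F : fieldType) : [pchar F] =i pred0 ->
  forall m, m.+1%:R \is a @GRing.unit F.
Proof. by move=> F0 m; rewrite unitfE (proj1 (pcharf0P F) F0). Qed.

Lemma rmorph_natU (R S : unitRingType) (phi : {rmorphism R -> S}) :
  (forall m, m.+1%:R \is a @GRing.unit R) ->
  (forall m, m.+1%:R \is a @GRing.unit S).
Proof. by move=> RU m; rewrite -(rmorph_nat phi) rmorph_unit. Qed.

Lemma map_tlog (R S : comUnitRingType) (phi : {rmorphism R -> S}) N (p : {poly R}) :
  (forall m, m.+1%:R \is a @GRing.unit R) ->
  map_poly phi (tlog N p) = tlog N (map_poly phi p).
Proof.
move=> natU; rewrite /tlog rmorph_sum; apply: eq_bigr => m _ /=.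
rewrite linearZ /= rmorphXn rmorphB /= map_polyC coef_map; congr (_ *: _).
by rewrite !rmorphM !rmorphXn rmorphV ?natU // rmorph_nat rmorphN rmorph1.
Qed.

(** The outer variable is [t] and the inner one is [y]. *)
Definition ydeg (A : nzRingType) D (p : {poly {poly A}}) :=
  forall k, (size (p`_k)%R <= D.+1)%N.

Section Ydeg.
Variable (A : comNzRingType).
Implicit Types p q : {poly {poly A}}.

Lemma size_sum_le (I : Type) (r : seq I) (P : pred I) (G : I -> {poly A}) n :
  (forall i, P i -> (size (G i) <= n)%N) -> (size (\sum_(i <- r | P i) G i)%R <= n)%N.
Proof.
move=> Gn; elim/big_rec: _ => [|i x Pi xn]; first by rewrite size_poly0.
by rewrite (leq_trans (size_polyD _ _)) // geq_max Gn.
Qed.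

Lemma ydegM D E p q : ydeg D p -> ydeg E q -> ydeg (D + E) (p * q).
Proof.
move=> pD qE k; rewrite coefM; apply: size_sum_le => i _.
apply: leq_trans (size_polyMleq _ _) _.
move: (pD i) (qE (k - i)%N); move: (size p`_i) (size q`_(k - i)) => a b; lia.
Qed.

Lemma ydegX D p k : ydeg D p -> ydeg (k * D) (p ^+ k).
Proof.
move=> pD; elim: k => [|k IH]; last by rewrite exprS mulSn; apply: ydegM.
by rewrite expr0 mul0n => j; rewrite coef1; case: (_ == _); rewrite ?size_poly1 ?size_poly0.
Qed.

Lemma ydegC D (c : {poly A}) : (size c <= D.+1)%N -> ydeg D c%:P.
Proof. by move=> cD k; rewrite coefC; case: (_ == _); rewrite ?size_poly0. Qed.

Lemma ydeg_sum (I : Type) (r : seq I) (G : I -> {poly {poly A}}) D :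
  (forall i, ydeg D (G i)) -> ydeg D (\sum_(i <- r) G i).
Proof. by move=> GD k; rewrite coef_sum; apply: size_sum_le => i _; apply: GD. Qed.

End Ydeg.

Section Atom.
Variables (F : fieldType) (A : idomainType) (iota : {rmorphism F -> A}).
Hypothesis F0 : [pchar F] =i pred0.
Implicit Types p v w : {poly {poly A}}.

Let natF := pchar0_natU F0.
Let natA := rmorph_natU iota natF.
Let natB := rmorph_natU (@polyC A : {rmorphism A -> {poly A}}) natA.

(** The constant coefficient has its own bound [E]: for an atom it alone reaches the full degree in
    [y], and this gap makes the fractions in the logarithm proper. *)
Lemma ydeg_tlog_term N m p D E : (m < N)%N -> ydeg D (p - (p`_0)%:P) ->
    (size (p`_0)%R <= E.+1)%N ->
  ydeg (m.+1 * D + (N - m.+1) * E)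
    (((-1) ^+ m * m.+1%:R^-1 * p`_0 ^+ (N - m.+1)) *: (p - (p`_0)%:P) ^+ m.+1).
Proof.
move=> mN pD pE; rewrite -mul_polyC.
have -> : (-1) ^+ m * m.+1%:R^-1 = ((-1) ^+ m * m.+1%:R^-1)%:P :> {poly A}.
  rewrite polyCM polyC_exp polyCN; congr (_ * _).
  by rewrite -[RHS]/(polyC _) rmorphV ?natA // rmorph_nat.
rewrite addnC; apply: ydegM; last exact: ydegX.
rewrite polyCM -[X in ydeg X]add0n; apply: ydegM.
  by apply: ydegC; rewrite size_polyC; case: (_ != _).
by rewrite polyC_exp; apply: ydegX; apply: ydegC.
Qed.

Lemma ydeg_tlog N p D : ydeg D p -> ydeg (N * D) (tlog N p).
Proof.
move=> pD; apply: ydeg_sum => m.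
have -> : (N * D = m.+1 * D + (N - m.+1) * D)%N.
  by rewrite -mulnDl subnKC.
apply: ydeg_tlog_term => // k.
rewrite coefB (leq_trans (size_polyD _ _)) // size_polyN geq_max pD /=.
exact: ydegC.
Qed.

(** The functional is that of the coprime pair [v ^+ (e.+1 * M)], [w ^+ M]. It kills the summand in
    [L'] and evaluates the cofactor of [w ^+ M] at 0; the degree bound on [L] makes that cofactor
    reduced. The scalar [c] then removes [e.+1] and the surplus power of [v.[0]]. *)
Lemma proper_residue (v w : {poly F}) e M :
    coprimep v w -> v.[0] != 0 ->
  exists l : nat -> F, forall T L L' : {poly A},
    T = map_poly iota v ^+ (e * M) * e.+1%:R * L * map_poly iota w ^+ M
        + L' * map_poly iota v ^+ (e.+1 * M) ->
    (size L <= M * (size v).-1)%N ->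
  lcoef iota l T = iota (v.[0] ^+ M)^-1 * L.[0].
Proof.
move=> cop a0; have v0 : v != 0 by apply: contraNneq a0 => ->; rewrite horner0.
have := @residue_functional F A iota (v ^+ (e.+1 * M)) (w ^+ M).
rewrite expf_neq0 // coprimep_expl ?coprimep_expr // => /(_ isT isT)[l lP].
set a := v.[0] in a0 *; pose c := (e.+1%:R * a ^+ (e.+1 * M))^-1.
exists (fun i => c * l i) => T L L' TE sL.
have -> : lcoef iota (fun i => c * l i) T = iota c * lcoef iota l T.
  by rewrite /lcoef mulr_sumr; apply: eq_bigr => i _; rewrite rmorphM mulrCA.
rewrite TE -!(rmorphXn (map_poly iota)) linearD /= (proj1 (lP _)) addr0.
rewrite (proj2 (lP _)); last first.
  have -> : map_poly iota (v ^+ (e * M)) * e.+1%:R =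
     (e.+1%:R : A) *: map_poly iota (v ^+ (e * M)).
    by rewrite -polyC_natr mulrC mul_polyC.
  apply: leq_ltn_trans (size_polyMleq _ _) _.
  have := size_scale_leq (e.+1%:R : A) (map_poly iota (v ^+ (e * M))).
  have sX k : size (v ^+ k) = ((size v).-1 * k).+1.
    by rewrite -size_exp prednK // size_poly_gt0 expf_neq0.
  rewrite size_map_poly !sX; move: sL; set D := (size v).-1.
  set P := e.+1%:R *: map_poly iota _.
  move: (size P) (size L) => s1 s2; rewrite mulSn mulnDr.
  rewrite [(M * D)%N]mulnC; lia.
have -> k : iota c * (map_poly iota (v ^+ k) * e.+1%:R * L).[0] =
    iota c * (iota (a ^+ k) * e.+1%:R) * L.[0].
  rewrite !hornerM -polyC_natr hornerC -{1}(rmorph0 iota) horner_map /=.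
  by rewrite horner_exp !mulrA.
rewrite -(rmorph_nat iota) -!rmorphM; congr (iota _ * _).
have e0 : e.+1%:R != 0 :> F by rewrite -unitfE natF.
rewrite /c mulSn exprD; move: (expf_neq0 M a0) (expf_neq0 (e * M) a0) e0.
move: (a ^+ M) (a ^+ (e * M)) (e.+1%:R) => x y z x0 y0 z0.
by field; rewrite x0 y0 z0.
Qed.

(* The partial fraction projection: [tlog p / p0^N] is the truncation of
   [log (p / p0) = (e+1) log (v / v0) + log (w / w0)], and the coefficients of
   [log (v / v0)] are proper fractions whose denominators are powers of [v0]. *)
Lemma atom_functional N e p v w (v0 w0 : {poly F}) :
    tmod N.+1 p (v ^+ e.+1 * w) -> p`_0 != 0 ->
    v`_0 = map_poly iota v0 -> w`_0 = map_poly iota w0 ->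
    coprimep v0 w0 -> v0.[0] != 0 -> (1 < size v0)%N ->
    (forall k, (0 < k)%N -> (size (v`_k)%R < size v0)%N) ->
  exists l : nat -> F,
    tmod N (map_poly (horner_eval 0) v)^`()
      ((map_poly (lcoef iota l) (tlog N.+1 p))^`() * map_poly (horner_eval 0) v).
Proof.
move=> pE p0 vE wE cop a0 v0_gt1 vk.
have [l lP] := proper_residue e N.+1 cop a0; exists l.
have := fun k (kN : (k < N.+1)%N) => coef_tlog_factor natB p0 pE kN.
rewrite vE wE => lE.
(* In term [m] the factor [(v - v0) ^+ m.+1] has [y]-degree at most [m.+1 * (deg v0 - 1)] and the
   power of [v0] at most [(N - m) * deg v0]; the sum is below [N.+1 * deg v0]. *)
have sizeL k : (size ((tlog N.+1 v)`_k)%R <= N.+1 * (size v0).-1)%N.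
  rewrite coef_sum; apply: size_sum_le => m _.
  have := @ydeg_tlog_term N.+1 m v (size v0).-2 (size v0).-1 (ltn_ord m).
  have /[swap]/[apply] : (size (v`_0)%R <= (size v0).-1.+1)%N.
    by rewrite vE prednK ?size_poly // ltnW.
  have /[swap]/[apply] : ydeg (size v0).-2 (v - (v`_0)%:P).
    case=> [|j]; rewrite coefB coefC ?subrr ?size_poly0 // subr0.
    by have := vk j.+1 isT; case: (size v0) v0_gt1 => [|[|s]].
  move=> /(_ k)/leq_trans; apply; case: m => m /= mM; move: (size v0) v0_gt1 => s; nia.
have evL k : (k < N.+1)%N -> lcoef iota l (tlog N.+1 p)`_k =
   iota (v0.[0] ^+ N.+1)^-1 * ((tlog N.+1 v)`_k).[0].
  by move=> kN; apply: lP (lE k kN) (sizeL k).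
have dL := deriv_tlog natB N.+1 v.
move: {sizeL lE} (tlog N.+1 p) (tlog N.+1 v) evL dL => L Lv evL [r rE].
set a := v0.[0] in a0 evL *.
have EL : tmod N.+1 (map_poly (lcoef iota l) L)
    (iota (a ^+ N.+1)^-1 *: map_poly (horner_eval 0) Lv).
  by apply/tmodP => k kM; rewrite coef_map /= evL // coefZ coef_map.
(* It remains to evaluate [deriv_tlog] for [v] at [y = 0], where the power of the constant
   coefficient becomes [a ^+ N.+1] and cancels. *)
apply: tmod_sym; apply: tmod_trans (tmodMr _ (tmod_deriv EL)) _.
rewrite derivZ deriv_map -scalerAl -rmorphM /= rE.
rewrite rmorphD rmorphM /= -deriv_map scalerDr.
have v00 : (v`_0).[0] = iota a by rewrite vE -{1}(rmorph0 iota) horner_map.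
rewrite -polyC_exp map_polyC /= [horner_eval 0 (_ ^+ _)]horner_exp v00.
rewrite mul_polyC scalerA -rmorphXn -rmorphM mulVf ?expf_neq0 //.
rewrite rmorph1 scale1r rmorphM /= map_polyXn.
exists ('X * (iota (a ^+ N.+1)^-1 *: map_poly (horner_eval 0) r)).
rewrite -!mul_polyC; congr (_ + _); set R := map_poly _ r.
have -> : 'X^(N.+1) = 'X^N * 'X :> {poly A} by rewrite -exprSr.
by rewrite mulrCA -!mulrA; congr (_ * _); rewrite mulrCA.
Qed.

End Atom.

(** * Factorization over the fraction field *)


Section FieldFactor.
Variable K : fieldType.
Implicit Types p q u w : {poly K}.

(** Irreducibility over an arbitrary field need not be decidable, hence the appeal to excluded
    middle in the descent on the degree. *)
Lemma irreducible_factor p : (1 < size p)%N ->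
  exists2 u, irreducible_poly u & u %| p.
Proof.
have [n] := ubnP (size p); elim: n p => // n IH p; rewrite ltnS => pn p1.
have [irr|] := classic (irreducible_poly p); first by exists p.
move=> nirr; have [q [q1 qp qNp]] : exists q, [/\ size q != 1, q %| p & ~~ (q %= p)].
  apply: NNPP => H; apply: nirr; split=> // q q1 qp.
  by apply/negPn/negP => qNp; apply: H; exists q.
have p0 : p != 0 by rewrite -size_poly_gt0 ltnW.
have q0 : q != 0 by apply: contraNneq p0 => q0; rewrite q0 dvd0p in qp.
have qsz : (size q < size p)%N by rewrite ltn_neqAle dvdp_size_eqp // qNp dvdp_leq.
have [||u uirr uq] := IH q; first exact: leq_trans pn.
  by rewrite ltn_neqAle eq_sym q1 size_poly_gt0.
by exists u => //; apply: dvdp_trans uq qp.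
Qed.

Lemma size_mul_gt q u : q != 0 -> (1 < size u)%N -> (size q < size (q * u)%R)%N.
Proof.
move=> q0 u1; have u0 : u != 0 by rewrite -size_poly_gt0 ltnW.
rewrite size_mul //; rewrite -size_poly_gt0 in q0.
by move: (size q) (size u) q0 u1 => a b; lia.
Qed.

Lemma multiplicity p u : p != 0 -> (1 < size u)%N ->
  exists e w, p = u ^+ e * w /\ ~~ (u %| w).
Proof.
have [n] := ubnP (size p); elim: n p => // n IH p; rewrite ltnS => pn p0 u1.
have [/dvdpP[q pE]|up] := boolP (u %| p); last by exists 0, p; rewrite mul1r.
have q0 : q != 0 by apply: contraNneq p0 => q0; rewrite pE q0 mul0r.
have [|//|//|e [w [qE uw]]] := IH q.
  by apply: leq_trans pn; rewrite pE; apply: size_mul_gt.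
by exists e.+1, w; rewrite pE qE exprS; split=> //; ring.
Qed.

(** Irreducible factors [u] of [q] are split off one by one while [p] stays fixed: the exponent is
    the full multiplicity of [u] in [p], positive since [u] divides [q], and irreducibility turns
    non-divisibility of [w] into coprimality. *)
Lemma coprime_factorization p q : p != 0 -> q %| p ->
  exists us : seq {poly K}, exists2 c, q = c *: \prod_(u <- us) u &
    forall u, u \in us -> (1 < size u)%N /\
      exists e w, p = u ^+ e.+1 * w /\ coprimep u w.
Proof.
move=> p0; have [n] := ubnP (size q); elim: n q => // n IH q; rewrite ltnS => qn qp.
have q0 : q != 0 by apply: contraNneq p0 => q0; rewrite q0 dvd0p in qp.
have [q1|] := leqP (size q) 1.
  exists [::], q`_0 => //; rewrite big_nil alg_polyC; exact: size1_polyC.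
move=> /irreducible_factor[u uirr uq]; case/dvdpP: (uq) => q' qE.
have u1 : (1 < size u)%N by case: uirr.
have q'0 : q' != 0 by apply: contraNneq q0 => q'0; rewrite qE q'0 mul0r.
have [||us [c q'E usP]] := IH q'.
- by apply: leq_trans qn; rewrite qE; apply: size_mul_gt.
- by apply: dvdp_trans qp; rewrite qE dvdp_mulr.
exists (u :: us), c; first by rewrite big_cons qE q'E -scalerAl mulrC.
move=> x; rewrite inE => /orP[/eqP ->|]; last exact: usP.
split=> //; have [e [w [pE uw]]] := multiplicity p0 u1.
case: e pE => [|e] pE.
  have := dvdp_trans uq qp.
  by rewrite pE mul1r => uw'; rewrite uw' in uw.
exists e, w; split=> //; rewrite -[coprimep _ _]negbK; apply: contra uw => cop.
have := uirr.2 (gcdp u w) cop (dvdp_gcdl _ _).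
by move/eqp_dvdl => <-; apply: dvdp_gcdr.
Qed.

End FieldFactor.

(** * Clearing denominators *)

Section Clearing.
Variable A : idomainType.
Local Notation K := {fraction A}.
Local Notation fr := (@tofrac A).
Implicit Types (p q v w : {poly A}).


Lemma tofrac_inj : injective fr.
Proof. by move=> x y /eqP; rewrite tofrac_eq => /eqP. Qed.

Lemma frac_clear (x : K) : exists2 c, c != 0 & exists a, fr c * x = fr a.
Proof.
elim/quotW: x => y; exists \d_y; first exact: denom_ratioP.
exists \n_y; rewrite /fr; unlock FracField.tofrac.
rewrite -[LHS]FracField.pi_mul /FracField.mulf /= !numden_Ratio ?oner_neq0 ?mul1r //.
apply/eqmodP; rewrite /= FracField.equivfE !numden_Ratio ?oner_neq0 ?denom_ratioP //.
by rewrite mulr1 mulrC.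
Qed.

Lemma poly_clear (p : {poly K}) :
  exists2 c, c != 0 & exists q, fr c *: p = map_poly fr q.
Proof.
elim/poly_ind: p => [|p x [c c0 [q qE]]].
  by exists 1; rewrite ?oner_neq0 //; exists 0; rewrite scaler0 rmorph0.
have [d d0 [a aE]] := frac_clear x.
exists (c * d); rewrite ?mulf_neq0 //; exists (d *: q * 'X + (c * a)%:P).
rewrite rmorphD /= [map_poly _ (_ * 'X)]rmorphM /= map_polyX map_polyC map_polyZ /= !rmorphM /=.
rewrite -qE -aE -!mul_polyC; move: ('X : {poly K}) => X.
rewrite [in LHS]polyCM ![in RHS]polyCM.
by move: (fr c)%:P (fr d)%:P x%:P => y z t; ring.
Qed.

(** Says without fractions that [p] is [v ^+ e.+1 * w] up to a scalar with [v] and [w] coprime over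
    the fraction field. Both facts survive any specialization at which [c] and [r] stay non-zero. *)
Definition atom (p v : {poly A}) : Prop :=
  exists (e : nat) (w s s' : {poly A}) (c r : A),
    [/\ c *: p = v ^+ e.+1 * w, s * v + s' * w = r%:P, c != 0 & r != 0].

Lemma atom_clear (p : {poly A}) (u : {poly K}) :
    (exists e (w : {poly K}), map_poly fr p = u ^+ e.+1 * w /\ coprimep u w) ->
  exists2 c, c != 0 & exists2 v, fr c *: u = map_poly fr v & atom p v.
Proof.
move=> [e [w [pE /Bezout_eq1_coprimepP[[s s'] /= bez]]]].
have [c c0 [v vE]] := poly_clear u; exists c => //; exists v => //.
have [c1 c10 [w1 w1E]] := poly_clear w.
have [c2 c20 [t tE]] := poly_clear s; have [c3 c30 [t' t'E]] := poly_clear s'.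
(* The scalar [c ^+ e.+1 * c1] clears the product [u ^+ e.+1 * w], and [c * c1 * c2 * c3] clears
   both terms of the Bezout identity. *)
exists e, w1, (c1 * c3 *: t), (c * c2 *: t'), (c ^+ e.+1 * c1), (c * c1 * c2 * c3).
have frI := map_inj_poly tofrac_inj (rmorph0 fr).
split; rewrite ?mulf_neq0 ?expf_neq0 //.
  apply: frI; rewrite map_polyZ [map_poly fr (_ * _)]rmorphM /=.
  rewrite [map_poly fr (_ ^+ _)]rmorphXn /= -vE -w1E pE !rmorphM !rmorphXn /=.
  rewrite -!mul_polyC [in LHS]polyCM polyC_exp exprMn.
  move: (fr c)%:P (fr c1)%:P => x y; ring.
apply: frI; rewrite rmorphD /= ![map_poly fr (_ * _)]rmorphM /= !map_polyZ map_polyC /=.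
rewrite -vE -w1E -tE -t'E -[RHS]mulr1 -bez !rmorphM /= -!mul_polyC.
rewrite ?polyCM.
by move: (fr c)%:P (fr c1)%:P (fr c2)%:P (fr c3)%:P => x y z x'; ring.
Qed.

(** Over the fraction field [q] is an unknown scalar times the product of the atoms. Comparing
    leading coefficients eliminates this scalar and leaves an identity over [A]. *)
Lemma atomic_factorization (p q h : {poly A}) : p != 0 -> p = q * h ->
  exists vs : seq {poly A},
    (\prod_(v <- vs) lead_coef v) *: q = lead_coef q *: \prod_(v <- vs) v /\
    forall v, v \in vs -> (1 < size v)%N /\ atom p v.
Proof.
move=> p0 pE; have fr0 : map_poly fr p != 0 by rewrite map_poly_eq0_id0 ?tofrac_eq0 ?lead_coef_eq0.
have frI := map_inj_poly tofrac_inj (rmorph0 fr).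
have : map_poly fr q %| map_poly fr p by rewrite pE rmorphM /= dvdp_mulr.
move=> /(coprime_factorization fr0)[us [k kE usP]].
have [vs [k' vsE vsP]] : exists vs : seq {poly A}, exists2 k',
    \prod_(u <- us) u = k' *: \prod_(v <- vs) map_poly fr v &
    forall v, v \in vs -> (1 < size v)%N /\ atom p v.
  elim: us {kE} usP => [|u us IH] usP.
    by exists [::], 1; rewrite ?big_nil ?scale1r.
  have [|vs [k' vsE vsP]] := IH; first by move=> x xus; apply: usP; rewrite inE xus orbT.
  have [u1 /atom_clear[c c0 [v vE av]]] := usP u (mem_head _ _).
  have c0' : fr c != 0 by rewrite tofrac_eq0.
  exists (v :: vs), ((fr c)^-1 * k').
    rewrite !big_cons vsE -vE -!mul_polyC polyCM.
    transitivity (((fr c)^-1 * fr c)%:P * (u * (k'%:P * \prod_(v <- vs) map_poly fr v))).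
      by rewrite mulVf ?mul1r.
    by rewrite polyCM; ring.
  move=> x; rewrite inE => /orP[/eqP ->|]; last exact: vsP.
  split=> //; move: u1; rewrite -(size_scale _ c0') vE.
  by rewrite size_map_inj_poly ?rmorph0 //; apply: tofrac_inj.
exists vs; split=> //; apply: frI; rewrite !map_polyZ /=.
have E : map_poly fr q = (k * k') *: map_poly fr (\prod_(v <- vs) v).
  by rewrite kE vsE scalerA rmorph_prod.
rewrite E scalerA; congr (_ *: _).
have := congr1 lead_coef E; rewrite lead_coefZ !lead_coef_map_inj ?rmorph0 //; try exact: tofrac_inj.
by move=> ->; rewrite mulrC lead_coef_prod.
Qed.

End Clearing.

(** * Specialization at a point *)


Section Specialization.
Variables (F : fieldType) (A : idomainType) (iota : {rmorphism F -> A}).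
Variables (ev : {rmorphism A -> F}) (sigma : {rmorphism A -> {poly A}}).
Hypothesis F0 : [pchar F] =i pred0.
Hypothesis sigma_coef0 : forall p, (sigma p)`_0 = iota (ev p).
Hypothesis sigma_const : forall c, sigma (iota c) = (iota c)%:P.
Implicit Types (p q v w : {poly A}).

(* An element of [A[y]], seen as a power series in [t] along [sigma], with
   coefficients in [A[y]]. *)
Definition spread p : {poly {poly A}} := swapXY (map_poly sigma p).

HB.instance Definition _ := GRing.RMorphism.copy spread (swapXY \o map_poly sigma).

Lemma coef_spread p k i : (spread p)`_k`_i = (sigma p`_i)`_k.
Proof. by rewrite coef_swapXY coef_map. Qed.

Lemma spread_coef0 p : (spread p)`_0 = map_poly iota (map_poly ev p).
Proof. by apply/polyP => i; rewrite coef_spread sigma_coef0 !coef_map. Qed.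

Lemma horner_spread p (x : F) :
  map_poly (horner_eval (iota x)) (spread p) = sigma p.[iota x].
Proof. by rewrite -horner_polyC -(sigma_const x) horner_map. Qed.

(** Dividing [v] by its leading coefficient, a unit modulo [t^(N+1)], makes it monic in [y], so its
    higher coefficients in [t] have smaller [y]-degree, as [atom_functional] requires. The series
    [G] is the normalized atom at [y = 0]. *)
Lemma atom_specialize N p v e w s s' (c r : A) :
    c *: p = v ^+ e.+1 * w -> s * v + s' * w = r%:P -> (1 < size v)%N ->
    ev c != 0 -> ev r != 0 -> ev (lead_coef v) != 0 -> ev v.[0] != 0 ->
    map_poly ev p != 0 ->
  exists (l : nat -> F) (G : {poly A}),
    tmod N.+1 (sigma (lead_coef v) * G) (sigma v.[0]) /\
    tmod N G^`() ((map_poly (lcoef iota l) (tlog N.+1 (spread p)))^`() * G).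
Proof.
move=> pE bez v1 c0 r0 lc0 v00 p0.
set a := lead_coef v in lc0 *.
have inv x : ev x != 0 -> exists y, tmod N.+1 (sigma x * y) 1.
  by move=> x0; apply: tmod_inv; rewrite sigma_coef0 rmorph_unit ?unitfE.
have inv0 x y : ev x != 0 -> tmod N.+1 (sigma x * y) 1 -> y`_0 = iota (ev x)^-1.
  move=> x0 /tmodP/(_ 0 isT); rewrite coef0M sigma_coef0 coef1 /= => xy.
  have xU : iota (ev x) \is a GRing.unit by rewrite rmorph_unit ?unitfE.
  by apply: (mulrI xU); rewrite xy -rmorphM divff ?rmorph1.
have [y yP] := inv _ lc0; have [z zP] := inv _ c0.
have y0 := inv0 _ _ lc0 yP; have z0 := inv0 _ _ c0 zP.
(* [y] inverts the leading coefficient only modulo [t^(N+1)]; the truncation removes the higher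
   orders, where the degree bound [Vk] could fail. *)
pose V := take_poly N.+1 (y^:P * spread v).
pose W := (sigma a ^+ e.+1 * z)^:P * spread w.
have mulE (x : {poly A}) q k i : (x^:P * spread q)`_k`_i = (x * sigma q`_i)`_k.
  by rewrite /spread -swapXY_polyC -rmorphM coef_swapXY coefCM coef_map.
pose v0 := (ev a)^-1 *: map_poly ev v.
pose w0 := ((ev a) ^+ e.+1 / ev c) *: map_poly ev w.
have a0' : (ev a)^-1 != 0 by rewrite invr_eq0.
have sv : size v0 = size v by rewrite size_scale // size_map_poly_id0.
have VE : V`_0 = map_poly iota v0.
  apply/polyP => i; rewrite coef_take_poly mulE coef0M y0 sigma_coef0.
  by rewrite -rmorphM coef_map coefZ coef_map.
have WE : W`_0 = map_poly iota w0.
  apply/polyP => i; rewrite mulE !coef0M z0 coef0_exp !sigma_coef0.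
  by rewrite -rmorphXn -!rmorphM coef_map coefZ coef_map.
(* The top coefficient in [y] is 1 modulo [t^(N+1)], so it contributes to order 0 only. *)
have Vk k : (0 < k)%N -> (size (V`_k)%R < size v0)%N.
  move=> k0; rewrite sv -(prednK (ltnW v1)) ltnS; apply/leq_sizeP => i iv.
  rewrite coef_take_poly; case: ifP => kN; last by rewrite coef0.
  rewrite mulE; move: iv; rewrite leq_eqVlt => /orP[/eqP <-|iv].
    rewrite -/(lead_coef v) -/a mulrC (proj1 (tmodP _ _ _) yP) // coef1.
    by case: k k0 {kN}.
  rewrite [v`_i]nth_default ?rmorph0 ?mulr0 ?coef0 //.
  by move: iv; case: (size v) v1.
have cP : (sigma c)^:P * spread p = spread v ^+ e.+1 * spread w.
  rewrite -swapXY_polyC -rmorphM /= -map_polyC -rmorphM /= mul_polyC pE.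
  by rewrite -[LHS]/(spread _) rmorphM rmorphXn.
have PE : tmod N.+1 (spread p) (V ^+ e.+1 * W).
  apply: tmod_sym; apply: tmod_trans (tmodMr _ (tmodX _ (tmod_take _ _))) _.
  have -> : (y^:P * spread v) ^+ e.+1 * W =
      ((sigma a * y)^:P) ^+ e.+1 * ((sigma c * z)^:P * spread p).
    rewrite [(sigma c * z)^:P]rmorphM /= mulrAC cP /W !rmorphM /= rmorphXn /= !exprMn.
    by ring.
  rewrite -[X in tmod _ _ X]mul1r -[X in tmod _ _ (X * _)](expr1n _ e.+1) -[X in tmod _ _ (_ * X)]mul1r.
  have one : (1 : {poly A})^:P = 1 by rewrite rmorph1.
  apply: tmodM; first by apply: tmodX; rewrite -one; apply: tmod_map.
  by apply: tmodMr; rewrite -one; apply: tmod_map.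
have P0 : (spread p)`_0 != 0 by rewrite spread_coef0 map_poly_eq0.
(* The Bezout identity specializes to one with the non-zero constant [ev r]. *)
have cop : coprimep v0 w0.
  rewrite coprimepZl // coprimepZr ?mulf_neq0 ?expf_neq0 ?invr_eq0 //.
  apply/Bezout_coprimepP; exists (map_poly ev s, map_poly ev s') => /=.
  by rewrite -!(rmorphM (map_poly ev)) -rmorphD /= bez map_polyC /= polyC_eqp1.
have ev0 q : (map_poly ev q).[0] = ev q.[0] by rewrite -{1}(rmorph0 ev) horner_map.
have v0_0 : v0.[0] != 0 by rewrite hornerZ ev0 mulf_neq0.
have v0_1 : (1 < size v0)%N by rewrite sv.
have [l lP] := atom_functional F0 PE P0 VE WE cop v0_0 v0_1 Vk.
exists l, (map_poly (horner_eval 0) V); split=> //.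
apply: (@tmod_trans _ _ (sigma a * (y * sigma v.[0]))).
  apply: tmodMl; apply: tmod_trans (tmod_map _ (tmod_take _ _)) _.
  rewrite rmorphM /=; have -> : map_poly (horner_eval 0) y^:P = y.
    rewrite -map_poly_comp map_poly_id // => x _ /=.
    by rewrite /horner_eval hornerC.
  by rewrite -(rmorph0 iota) horner_spread; apply: tmod_refl.
by rewrite mulrA -[X in tmod _ _ X]mul1r; apply: tmodMr.
Qed.

End Specialization.

(** * A factor as an exponential *)


Section FactorExp.
Variables (F : fieldType) (A : idomainType) (iota : {rmorphism F -> A}).
Hypothesis F0 : [pchar F] =i pred0.
Implicit Types (p q v w : {poly A}).

(** [ev] is evaluation at a point, and [sigma] restriction to a curve in the parameter [t] that
    starts there. *)
Definition admissible (ev : {rmorphism A -> F}) (sigma : {rmorphism A -> {poly A}}) :=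
  (forall a, (sigma a)`_0 = iota (ev a)) /\ (forall c, sigma (iota c) = (iota c)%:P).

(** The series [G] of the atoms multiply, so their logarithmic derivatives add and one functional
    serves them all. [D] collects the finitely many elements that must not vanish, before the point,
    the curve and the order are chosen. *)
Lemma atoms_specialize p (vs : seq {poly A}) : p != 0 ->
    (forall v, v \in vs -> [/\ (1 < size v)%N, atom p v & v.[0] != 0]) ->
  exists2 D : A, D != 0 & forall ev sigma N, admissible ev sigma -> ev D != 0 ->
    ev (\prod_(v <- vs) lead_coef v) != 0 /\
    exists (l : nat -> F) (G : {poly A}),
      tmod N.+1 (sigma (\prod_(v <- vs) lead_coef v) * G)
                (sigma (\prod_(v <- vs) v.[0])) /\
      tmod N G^`() ((map_poly (lcoef iota l) (tlog N.+1 (spread sigma p)))^`() * G).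
Proof.
move=> p0; elim: vs => [|v vs IH] vsP.
  exists 1; rewrite ?oner_neq0 // => ev sigma N _ _; split.
    by rewrite big_nil rmorph1 oner_neq0.
  exists (fun=> 0), 1; rewrite !big_nil mulr1; split; first exact: tmod_refl.
  rewrite derivC (_ : map_poly _ _ = 0) ?linear0 ?mul0r; first exact: tmod_refl.
  apply/polyP => i; rewrite coef_map /= coef0 /lcoef big1 // => j _.
  by rewrite rmorph0 mulr0.
have [|D D0 DP] := IH; first by move=> x xvs; apply: vsP; rewrite inE xvs orbT.
have [v1 [e [w [s [s' [c [r [pE bez c0 r0]]]]]]] v00] := vsP v (mem_head _ _).
(* The first four new factors are the conditions of [atom_specialize]; [lead_coef p] keeps the
   specialized [p] non-zero. *)
exists (D * (c * r * lead_coef v * v.[0] * lead_coef p)).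
  by rewrite !mulf_neq0 ?lead_coef_eq0 // -size_poly_gt0 ltnW.
move=> ev sigma N adm; rewrite !rmorphM /= !mulf_eq0 !negb_or.
move=> /andP[evD /andP[/andP[/andP[/andP[evc evr] evl] evv] evp]].
have [evL [l [G [GE dG]]]] := DP ev sigma N adm evD.
have pev : map_poly ev p != 0.
  by apply: contraNneq evp => p'; rewrite -coef_map p' coef0.
have [l' [G' [GE' dG']]] :=
  atom_specialize F0 adm.1 adm.2 N pE bez v1 evc evr evl evv pev.
rewrite big_cons; split; first by rewrite rmorphM mulf_neq0.
exists (fun i => l' i + l i), (G' * G); split.
  rewrite !big_cons !rmorphM /= mulrACA; exact: tmodM.
have -> : map_poly (lcoef iota (fun i => l' i + l i)) (tlog N.+1 (spread sigma p)) =
   map_poly (lcoef iota l') (tlog N.+1 (spread sigma p)) +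
   map_poly (lcoef iota l) (tlog N.+1 (spread sigma p)).
  by apply/polyP => i; rewrite coefD !coef_map /= lcoefD.
move: dG dG'; move: (map_poly _ _) (map_poly _ _) => L L' dG dG'.
rewrite derivM derivD; have [x ->] := dG; have [y ->] := dG'.
by exists (x * G' + y * G); ring.
Qed.

(** With a constant leading coefficient the atomic factorization at [y = 0] reads
    [prod lc(v) * q(0) = k * prod v(0)]. Cancelling [prod lc(v)] along [sigma] shows that [q(0)]
    becomes [k * G], which solves the equation of the exponential. *)
Lemma factor_exp p q h k : p != 0 -> p = q * h -> q.[0] != 0 -> lead_coef q = iota k ->
  exists2 D : A, D != 0 & forall ev sigma N, admissible ev sigma -> ev D != 0 ->
    exists l : nat -> F, tmod N.+1 (sigma q.[0])
      (iota (ev q.[0]) *: texp N.+1 (map_poly (lcoef iota l) (tlog N.+1 (spread sigma p)))).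
Proof.
move=> p0 pE q0 lq; have [vs [vsE vsP]] := atomic_factorization p0 pE.
have vsE0 : (\prod_(v <- vs) lead_coef v) * q.[0] = iota k * \prod_(v <- vs) v.[0].
  by rewrite -hornerZ vsE lq hornerZ horner_prod.
have vs0 v : v \in vs -> [/\ (1 < size v)%N, atom p v & v.[0] != 0].
  move=> vvs; have [v1 av] := vsP v vvs; split=> //.
  have : iota k * \prod_(v <- vs) v.[0] != 0.
    rewrite -vsE0 mulf_neq0 // prodf_seq_neq0; apply/allP => u /vsP[u1 _] /=.
    by rewrite lead_coef_eq0 -size_poly_gt0 ltnW.
  rewrite mulf_eq0 negb_or prodf_seq_neq0 => /andP[_ /allP/(_ v vvs)].
  by [].
have [D D0 DP] := atoms_specialize p0 vs0; exists D => // ev sigma N adm evD.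
have [evL [l [G [GE dG]]]] := DP ev sigma N adm evD; exists l.
move: dG; set L := map_poly _ _ => dG.
have L0 : L`_0 = 0 by rewrite coef_map /= tlog_coef0 linear0.
have qG : tmod N.+1 (sigma q.[0]) ((iota k)%:P * G).
  have s0 : (sigma (\prod_(v <- vs) lead_coef v))`_0 != 0.
    by rewrite adm.1 fmorph_eq0.
  apply: (tmod_cancel s0); rewrite -rmorphM vsE0 rmorphM /= adm.2 mulrCA.
  by apply: tmodMl; apply: tmod_sym.
have natA := rmorph_natU iota (pchar0_natU F0).
rewrite -adm.1; apply: tmod_ode_exp => //.
apply: tmod_trans (tmod_deriv qG) _; rewrite deriv_mulC.
apply: tmod_trans (tmodMl _ dG) _; rewrite mulrCA; apply: tmodMl.
by apply: tmod_sym; apply: tmodW qG.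
Qed.

End FactorExp.

(** * Multivariate polynomials restricted to lines *)


Lemma mpoly_rmorph_ext n (R S : comNzRingType) (h1 h2 : {rmorphism {mpoly R[n]} -> S}) :
  (forall c, h1 c%:MP = h2 c%:MP) -> (forall i, h1 'X_i = h2 'X_i) -> h1 =1 h2.
Proof.
move=> hC hX p; rewrite (mpolyE p) !rmorph_sum; apply: eq_bigr => m _.
rewrite -mul_mpolyC !rmorphM /= hC; congr (_ * _).
by rewrite mpolyXE_id !rmorph_prod; apply: eq_bigr => i _; rewrite !rmorphXn /= hX.
Qed.

Lemma poly_nonroot_nat (A : idomainType) (p : {poly A}) :
  (forall m, m.+1%:R \is a @GRing.unit A) -> p != 0 -> exists k : nat, p.[k%:R] != 0.
Proof.
move=> natU p0; pose rs := [seq k%:R : A | k <- iota 0 (size p)].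
have [/allP all_rs|] := boolP (all (root p) rs); last first.
  by move=> /allPn[_ /mapP[k _ ->] pk]; exists k.
suff urs : uniq rs.
  have := max_poly_roots p0 (introT allP all_rs) urs.
  by rewrite size_map size_iota ltnn.
rewrite map_inj_uniq ?iota_uniq // => i j.
wlog ij : i j / (i <= j)%N => [W|].
  by have [/W|/ltnW ji] := leqP i j; [apply | move=> /esym; move/(W _ _ ji)].
move=> /eqP; rewrite eq_sym -subr_eq0 -natrB //.
case: (j - i)%N (subnKC ij) => [|k]; first by rewrite addn0.
by move=> _ /eqP k0; have := natU k; rewrite k0 unitr0.
Qed.

Lemma coef_muni n (R : comNzRingType) (p : {mpoly R[n.+1]}) (m : 'X_{1..n.+1}) :
  mcoeff [multinom m (widen_ord (leqnSn n) i) | i < n] (muni p)`_(m ord_max) = p@_m.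
Proof.
rewrite muniE coef_sum raddf_sum /= [in RHS](mpolyE p) raddf_sum /=.
apply: eq_bigr => m' _; rewrite coefZ coefXn mcoeffZ mcoeffX.
have [->|mm] := eqVneq m' m; first by rewrite eqxx mulr1 mcoeffZ mcoeffX eqxx.
rewrite mulr0; have [mo|] := eqVneq; last by rewrite mulr0 mcoeff0.
rewrite mulr1 mcoeffZ mcoeffX; have [/mnmP me|] := eqVneq; last by rewrite mulr0.
case/eqP: mm; apply/mnmP => i; have [->|/eqP ni] := eqVneq i ord_max; first by rewrite -mo.
have lin : (i < n)%N.
  by have := ltn_ord i; rewrite ltnS leq_eqVlt => /orP[/eqP ie|//]; case: ni; apply/val_inj.
have := me (Ordinal lin); rewrite !mnmE.
by have -> : widen_ord (leqnSn n) (Ordinal lin) = i by apply/val_inj.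
Qed.

(** Induction on the variables: [muni] isolates the last one, some natural number is not a root in
    it, and the value there is a non-zero polynomial in the others. *)
Lemma mpoly_nonroot (F : fieldType) n (p : {mpoly F[n]}) :
  [pchar F] =i pred0 -> p != 0 -> exists b : 'I_n -> F, p.@[b] != 0.
Proof.
move=> F0; elim: n p => [|n IH] p p0.
  exists (fun=> 0); apply: contraNneq p0 => pb; apply/eqP.
  suff {}pC : p = (p@_0)%:MP by move: pb; rewrite pC mevalC => ->; rewrite mpolyC0.
  apply: msize1_polyC; rewrite msizeE; apply/bigmax_leqP_seq => m _ _.
  by rewrite mdegE big_ord0.
have q0 : muni p != 0.
  apply: contraNneq p0 => q0; apply/eqP/mpolyP => m.
  by rewrite mcoeff0 -coef_muni q0 coef0 mcoeff0.
have natA := rmorph_natU (@mpolyC n F : {rmorphism F -> {mpoly F[n]}}) (pchar0_natU F0).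
have [k /IH[b bP]] := poly_nonroot_nat natA q0.
pose c i := match split (cast_ord (esym (addn1 n)) i) with
  | inl j => b j | inr _ => k%:R end.
exists c; suff -> : p.@[c] = (muni p).[k%:R].@[b] by [].
pose phi := (meval b \o (horner_eval (k%:R : {mpoly F[n]}) \o @muni n F)).
rewrite -[RHS]/(phi p); apply: mpoly_rmorph_ext => [x|i] /=.
  by rewrite mevalC /horner_eval muniC hornerC mevalC.
rewrite mevalXU /horner_eval /muni mmapX mmap1U /c.
by case: split => j; rewrite ?hornerC ?hornerX ?mevalXU // rmorph_nat.
Qed.

Section PolyTop.
Variable S : comNzRingType.

(** A formal leading coefficient: [c] may be zero, so products need no case distinction. *)
Definition top_at (e : nat) (p : {poly S}) (c : S) := (size p <= e.+1)%N /\ p`_e = c.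

Lemma top_atM e1 e2 p1 p2 c1 c2 :
  top_at e1 p1 c1 -> top_at e2 p2 c2 -> top_at (e1 + e2) (p1 * p2) (c1 * c2).
Proof.
move=> [s1 <-] [s2 <-]; split.
  by apply: leq_trans (size_polyMleq _ _) _; move: (size p1) (size p2) s1 s2 => x y; lia.
have lt : (e1 < (e1 + e2).+1)%N by rewrite ltnS leq_addr.
rewrite coefM (bigD1 (Ordinal lt)) //= addKn big1 ?addr0 // => i ie.
have [ei|] := ltnP e1 i; first by rewrite [p1`_i]nth_default ?mul0r // (leq_trans s1).
rewrite leq_eqVlt => /orP[/eqP ie'|ei]; first by case/eqP: ie; apply/val_inj.
rewrite [p2`__]nth_default ?mulr0 //; apply: leq_trans s2 _; lia.
Qed.

Lemma top_atX e p c k : top_at e p c -> top_at (k * e) (p ^+ k) (c ^+ k).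
Proof.
move=> pe; elim: k => [|k IH]; first by rewrite !expr0; split; rewrite ?size_poly1 ?coef1.
by rewrite !exprS mulSn; apply: top_atM.
Qed.

Lemma top_at_mmap1 n (h : 'I_n -> {poly S}) c (m : 'X_{1..n}) :
  (forall i, top_at 1 (h i) (c i)) -> top_at (mdeg m) (mmap1 h m) (mmap1 c m).
Proof.
move=> hc; rewrite mdegE /mmap1; elim/big_ind3: _ => [||i _].
- by split; rewrite ?size_poly1 ?coef1.
- by move=> x1 x2 x3 y1 y2 y3; apply: top_atM.
by have := top_atX (m i) (hc i); rewrite muln1.
Qed.

Lemma size_mmap n (R : comNzRingType) (f : {rmorphism R -> {poly S}}) (h : 'I_n -> {poly S})
    (p : {mpoly R[n]}) :
  (forall c, (size (f c) <= 1)%N) -> (forall i, (size (h i) <= 2)%N) ->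
  (size (mmap f h p) <= msize p)%N.
Proof.
move=> fC hX; rewrite /mmap big_seq; apply: size_sum_le => m mp.
have [s _] := @top_at_mmap1 _ h (fun i => (h i)`_1) m (fun i => conj (hX i) erefl).
apply: leq_trans (size_polyMleq _ _) _.
have := msize_mdeg_lt mp; have := fC p@_m; move: s.
move: (size (f _)) (size (mmap1 h m)) => x y; lia.
Qed.

End PolyTop.

Section Line.
Variables (F : fieldType) (n : nat).
Local Notation A := {mpoly F[n]}.

Definition line_form (a : 'I_n -> F) (i : 'I_n) : {poly A} :=
  (a i)%:MP *: 'X + ('X_i)%:P.

Definition line (a : 'I_n -> F) (p : A) : {poly A} :=
  mmap (@polyC A \o @mpolyC n F) (line_form a) p.

HB.instance Definition _ a :=
  GRing.RMorphism.copy (line a) (mmap (@polyC A \o @mpolyC n F) (line_form a)).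

Lemma lineC a c : line a c%:MP = (c%:MP)%:P.
Proof. exact: mmapC. Qed.

Lemma lineX a i : line a 'X_i = (a i)%:MP *: 'X + ('X_i)%:P.
Proof. by rewrite /line mmapX mmap1U. Qed.

Lemma line_form_top a i : top_at 1 (line_form a i) (a i)%:MP.
Proof.
split; last by rewrite coefD coefZ coefX coefC mulr1 addr0.
rewrite (leq_trans (size_polyD _ _)) // geq_max.
rewrite (leq_trans (size_scale_leq _ _)) ?size_polyX //.
by rewrite (leq_trans (size_polyC_leq1 _)).
Qed.

Lemma size_line a p : (size (line a p) <= msize p)%N.
Proof.
apply: size_mmap => [c|i]; last by case: (line_form_top a i).
exact: size_polyC_leq1.
Qed.

Definition top_form (p : A) : A :=
  \sum_(m <- msupp p | mdeg m == (msize p).-1) p@_m *: 'X_[m].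

Lemma top_form_neq0 p : p != 0 -> top_form p != 0.
Proof.
move=> p0; apply/eqP => /(congr1 (mcoeff (mlead p))).
rewrite mcoeff0 raddf_sum /= big_mkcond (bigD1_seq (mlead p)) ?msupp_uniq //=; last first.
  exact: mlead_supp.
rewrite -mlead_deg //= eqxx mcoeffZ mcoeffX eqxx mulr1 big1 ?addr0 => [|m mp].
  by apply/eqP; rewrite mleadc_eq0.
by case: ifP => // _; rewrite mcoeffZ mcoeffX (negbTE mp) mulr0.
Qed.

(** Only monomials of maximal degree reach this power of [y], each with its value at the direction
    [a]. *)
Lemma coef_line_top a p : (line a p)`_(msize p).-1 = ((top_form p).@[a])%:MP.
Proof.
have -> : (top_form p).@[a] =
    \sum_(m <- msupp p | mdeg m == (msize p).-1) p@_m * mmap1 a m.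
  rewrite /top_form (raddf_sum (meval a)); apply: eq_bigr => m _.
  by rewrite /= mevalZ mevalX.
rewrite rmorph_sum /line /mmap coef_sum [in RHS]big_mkcond /=.
rewrite big_seq [in RHS]big_seq; apply: eq_bigr => m mp; rewrite coefCM.
have [s c] := top_at_mmap1 m (line_form_top a).
have := msize_mdeg_lt mp; case: (msize p) => // k; rewrite ltnS /= => mk.
case: eqVneq => [<-|mk']; last first.
  by rewrite nth_default ?mulr0 // (leq_trans s) // ltn_neqAle mk'.
rewrite c mpolyCM /mmap1 rmorph_prod; congr (_ * _).
by apply: eq_bigr => i _; rewrite rmorphXn.
Qed.

(** Provides the constant leading coefficient required by [factor_exp]. *)
Lemma lead_coef_line a p : (top_form p).@[a] != 0 ->
  lead_coef (line a p) = ((top_form p).@[a])%:MP.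
Proof.
move=> pa; rewrite -coef_line_top lead_coefE; congr (_ `_ _.-1).
have p0 : p != 0.
  by apply: contraNneq pa => ->; rewrite /top_form msupp0 big_nil meval0.
apply/eqP; rewrite eqn_leq size_line /=.
rewrite -{1}(prednK (_ : 0 < msize p)%N) ?lt0n ?msize_poly_eq0 //.
rewrite ltnNge; apply: contra pa => /(nth_default 0).
by rewrite coef_line_top => /eqP; rewrite mpolyC_eq0.
Qed.

Lemma horner0_line a p : (line a p).[0] = p.
Proof.
rewrite -[LHS]/((horner_eval 0 \o line a) p) -[RHS]/(idfun p).
apply: mpoly_rmorph_ext => [c|i] /=; rewrite /horner_eval ?lineC ?lineX ?hornerC //.
by rewrite hornerD hornerZ hornerX hornerC mulr0 add0r.
Qed.

End Line.

(** * The closed formula *)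


(** Lagrange interpolation at [0, ..., T - 1], distinct in characteristic zero; the weight [mu u] is
    the value of the functional on the Lagrange polynomial of node [u]. *)
Lemma lcoef_interpolation (F : fieldType) (A : idomainType)
    (iota : {rmorphism F -> A}) (T : nat) (l : nat -> F) :
    [pchar F] =i pred0 ->
  exists mu : nat -> F, forall p : {poly A}, (size p <= T)%N ->
    lcoef iota l p = \sum_(u < T) iota (mu u) * p.[iota u%:R].
Proof.
move=> F0; case: T => [|T].
  exists (fun=> 0) => p; rewrite leqn0 size_poly_eq0 => /eqP ->.
  by rewrite linear0 big_ord0.
pose x (i : nat) : F := i%:R.
have x_inj : injective x.
  move=> i j /eqP; rewrite /x; wlog ij : i j / (i <= j)%N => [W|].
    by have [/W|/ltnW /W ji] := leqP i j; [apply | rewrite eq_sym => /ji].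
  rewrite eq_sym -subr_eq0 -natrB // (proj1 (pcharf0P F) F0) subn_eq0 => ji.
  by apply/eqP; rewrite eqn_leq ij.
pose L (u : 'I_T.+1) : {poly F} := tnth (lagrange T.+1 x) u.
have LE (u v : 'I_T.+1) : (L u).[v%:R] = (u == v)%:R by apply: lagrange_sample.
have sL u : (size (L u) <= T.+1)%N by rewrite size_lagrange_.
exists (fun u => \sum_(i < size (L (inord u))) (L (inord u))`_i * l i) => p pT.
have pE : p = \sum_(u < T.+1) p.[iota u%:R] *: map_poly iota (L u).
  apply/eqP; rewrite -subr_eq0; apply/eqP.
  apply: (@roots_geq_poly_eq0 _ _ [seq iota (val v)%:R | v <- enum 'I_T.+1]).
  - apply/allP => _ /mapP[v _ ->]; rewrite /root hornerD hornerN horner_sum.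
    rewrite (bigD1 v) //= hornerZ horner_map /= LE eqxx rmorph1 mulr1 big1 ?addr0 ?subrr //.
    by move=> u uv; rewrite hornerZ horner_map /= LE (negbTE uv) rmorph0 mulr0.
  - rewrite map_inj_uniq ?enum_uniq // => u v /fmorph_inj/x_inj.
    exact: val_inj.
  - rewrite size_map size_enum_ord (leq_trans (size_polyD _ _)) // geq_max pT.
    rewrite size_polyN; apply: size_sum_le => u _.
    by rewrite (leq_trans (size_scale_leq _ _)) // size_map_poly.
rewrite {1}pE linear_sum; apply: eq_bigr => u _.
by rewrite linearZ /= lcoef_map inord_val mulrC.
Qed.

Section ClosedForm.
Variables (F : fieldType) (n : nat).
Local Notation A := {mpoly F[n]}.
Local Notation iota := (@mpolyC n F : {rmorphism F -> A}).

(** The segment from the point [b] at [t = 0] to the generic point at [t = 1]. *)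
Definition disp_form (b : 'I_n -> F) (i : 'I_n) : {poly A} :=
  ((b i)%:MP)%:P + ('X_i - (b i)%:MP) *: 'X.

Definition disp (b : 'I_n -> F) (p : A) : {poly A} :=
  mmap (@polyC A \o @mpolyC n F) (disp_form b) p.

HB.instance Definition _ b :=
  GRing.RMorphism.copy (disp b) (mmap (@polyC A \o @mpolyC n F) (disp_form b)).

Lemma dispC b c : disp b c%:MP = (c%:MP)%:P.
Proof. exact: mmapC. Qed.

Lemma dispX b i : disp b 'X_i = disp_form b i.
Proof. by rewrite /disp mmapX mmap1U. Qed.

Lemma disp_admissible b : admissible iota (meval b) (disp b).
Proof.
split=> [p|c]; last exact: dispC.
rewrite -horner_coef0 -[LHS]/((horner_eval 0 \o disp b) p).
rewrite -[RHS]/((@mpolyC n F \o meval b) p).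
apply: mpoly_rmorph_ext => [c|i] /=; rewrite /horner_eval ?dispC ?dispX.
  by rewrite hornerC mevalC.
by rewrite hornerD hornerZ hornerX hornerC mulr0 addr0 mevalXU.
Qed.

Lemma horner1_disp b p : (disp b p).[1] = p.
Proof.
rewrite -[LHS]/((horner_eval 1 \o disp b) p) -[RHS]/(idfun p).
apply: mpoly_rmorph_ext => [c|i] /=; rewrite /horner_eval ?dispC ?dispX ?hornerC //.
by rewrite hornerD hornerZ hornerX hornerC mulr1 addrC subrK.
Qed.

Definition affine_sub (v : F) (c : 'I_n -> F) (p : A) : A :=
  mmap (@mpolyC n F) (fun i => v *: 'X_i + (c i)%:MP) p.

HB.instance Definition _ v c :=
  GRing.RMorphism.copy (affine_sub v c)
    (mmap (@mpolyC n F) (fun i => v *: 'X_i + (c i)%:MP)).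

Lemma affine_subC v c x : affine_sub v c x%:MP = x%:MP.
Proof. exact: mmapC. Qed.

Lemma affine_subX v c i : affine_sub v c 'X_i = v *: 'X_i + (c i)%:MP.
Proof. by rewrite /affine_sub mmapX mmap1U. Qed.

(** At scalar nodes [y = u] and [t = v] both substitutions collapse into an affine one, so only
    affine substitutions of [f] have to be computed. *)
Lemma disp_line_horner a b u v p :
  (disp b (line a p).[u%:MP]).[v%:MP] =
    affine_sub v (fun i => a i * u + b i - v * b i) p.
Proof.
rewrite -[LHS]/((horner_eval (v%:MP) \o (disp b \o (horner_eval (u%:MP) \o line a))) p).
apply: mpoly_rmorph_ext => [c|i] /=; rewrite /horner_eval.
  by rewrite lineC hornerC dispC hornerC affine_subC.
rewrite lineX affine_subX hornerD hornerZ hornerX hornerC rmorphD rmorphM /=.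
rewrite !dispC dispX hornerD hornerM !hornerC hornerD hornerC hornerZ hornerX.
by rewrite -mul_mpolyC !mpolyCD mpolyCN !mpolyCM; ring.
Qed.

Lemma size_disp_form b i : (size (disp_form b i) <= 2)%N.
Proof.
rewrite (leq_trans (size_polyD _ _)) // geq_max.
rewrite (leq_trans (size_polyC_leq1 _)) //.
by rewrite (leq_trans (size_scale_leq _ _)) ?size_polyX.
Qed.

Lemma size_disp b p : (size (disp b p) <= msize p)%N.
Proof. by apply: size_mmap => [c|i]; [apply: size_polyC_leq1 | apply: size_disp_form]. Qed.

Lemma size_disp_line a b u p : (size (disp b (line a p).[u%:MP]) <= msize p)%N.
Proof.
pose h i := ((a i * u)%:MP)%:P + disp_form b i.
have -> : disp b (line a p).[u%:MP] = mmap (@polyC A \o @mpolyC n F) h p.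
  rewrite -[LHS]/((disp b \o (horner_eval (u%:MP) \o line a)) p).
  apply: mpoly_rmorph_ext => [c|i] /=; rewrite /horner_eval.
    by rewrite lineC hornerC dispC mmapC.
  rewrite lineX mmapX mmap1U hornerD hornerZ hornerX hornerC rmorphD rmorphM /=.
  by rewrite !dispC dispX /h mpolyCM polyCM.
apply: size_mmap => [c|i]; first exact: size_polyC_leq1.
rewrite (leq_trans (size_polyD _ _)) // geq_max size_disp_form andbT.
by rewrite (leq_trans (size_polyC_leq1 _)).
Qed.

(** The sum over [u] interpolates in [y], where the logarithm has degree at most [(d+1)d]; the sum
    over [v] interpolates in [t], where its powers up to the [d]-th have degree at most [d(d+1)d].
    The sum over [j] is the exponential and the one over [m] the logarithm, whose coefficients are
    absorbed into [mu]. *)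
Lemma factor_formula (d : nat) (f g : A) :
    [pchar F] =i pred0 -> f != 0 -> msize f = d.+1 -> (exists h, f = g * h) ->
  exists (nu : nat -> F) (mu : nat -> nat -> F) (c : nat -> F)
         (e : nat -> nat -> 'I_n -> F),
  g = \sum_(v < (d * (d.+1 * d)).+1) nu v *: \sum_(j < d.+1) (j`!)%:R^-1 *:
       (\sum_(u < (d.+1 * d).+1) \sum_(m < d.+1)
          mu u m *: (affine_sub v%:R (e u v) f - (c u)%:MP) ^+ m.+1) ^+ j.
Proof.
move=> F0 f0 fd [h fE].
have natF := pchar0_natU F0; have natA := rmorph_natU iota natF.
have natB := rmorph_natU (@polyC A : {rmorphism A -> {poly A}}) natA.
have [g0 h0] : g != 0 /\ h != 0 by apply/andP; move: f0; rewrite fE mulf_eq0 negb_or.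
have gd : (msize g <= d.+1)%N.
  rewrite -fd fE msizeM //; move: g0 h0; rewrite -!msize_poly_eq0.
  move: (msize g) (msize h) => x y; lia.
have [a aP] := mpoly_nonroot F0 (top_form_neq0 g0).
pose k := (top_form g).@[a].
have lead_g : lead_coef (line a g) = iota k by apply: lead_coef_line.
have line_f0 : line a f != 0.
  by apply: contraNneq f0 => fa; rewrite -(horner0_line a f) fa horner0.
have line_fE : line a f = line a g * line a h by rewrite fE rmorphM.
have line_g0 : (line a g).[0] != 0 by rewrite horner0_line.
have [D D0 DP] := factor_exp F0 line_f0 line_fE line_g0 lead_g.
have [b bP] := mpoly_nonroot F0 D0.
have [l] := DP _ _ d (disp_admissible b) bP.
rewrite horner0_line; set P := spread _ _; set L := map_poly _ _ => gE.
have sP : ydeg d P.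
  move=> j; apply/leq_sizeP => i di; rewrite coef_spread [(line a f)`_i]nth_default.
    by rewrite rmorph0 coef0.
  by rewrite (leq_trans (size_line _ _)) // fd.
have [mu muP] := lcoef_interpolation iota (d.+1 * d).+1 l F0.
pose fu u := disp b (line a f).[iota u%:R].
pose cu u := (line a f).[iota u%:R].@[b].
have LE : L = \sum_(u < (d.+1 * d).+1) iota (mu u) *: tlog d.+1 (fu u).
  apply/polyP => j; rewrite coef_map /= muP; last exact: (@ydeg_tlog F _ iota F0 d.+1 P d sP j).
  rewrite [in RHS]coef_sum; apply: eq_bigr => u _; rewrite [in RHS]coefZ; congr (_ * _).
  have [_ admC] := disp_admissible b.
  by rewrite /fu -(horner_spread admC) -map_tlog // coef_map.
have fu0 u : (fu u)`_0 = iota (cu u) by rewrite /fu (disp_admissible b).1.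
pose kap u m : F := mu u * ((-1) ^+ m * m.+1%:R^-1 * (cu u) ^+ (d.+1 - m.+1)).
have {}LE : L = \sum_(u < (d.+1 * d).+1) \sum_(m < d.+1)
    iota (kap u m) *: (fu u - (iota (cu u))%:P) ^+ m.+1.
  rewrite LE; apply: eq_bigr => u _; rewrite /tlog scaler_sumr.
  apply: eq_bigr => m _; rewrite scalerA fu0; congr (_ *: _).
  by rewrite !rmorphM !rmorphXn rmorphV ?natF // rmorph_nat rmorphN rmorph1.
have sfu (u : nat) c : (size (fu u - c%:P)%R <= d.+1)%N.
  rewrite (leq_trans (size_polyD _ _)) // geq_max -{1}fd size_disp_line size_polyN.
  by rewrite (leq_trans (size_polyC_leq1 _)).
have sL : (size L <= (d.+1 * d).+1)%N.
  rewrite LE; apply: size_sum_le => u _; apply: size_sum_le => m _.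
  apply: leq_trans (size_scale_leq _ _) _; apply: leq_trans (size_poly_exp_leq _ _) _.
  rewrite ltnS mulnC leq_mul //.
  by have := sfu u (iota (cu u)); case: (size _).
set E := _ *: texp _ _ in gE.
have sE : (size E <= (d * (d.+1 * d)).+1)%N.
  apply: leq_trans (size_scale_leq _ _) _; apply: size_sum_le => j _.
  apply: leq_trans (size_scale_leq _ _) _; apply: leq_trans (size_poly_exp_leq _ _) _.
  rewrite ltnS mulnC leq_mul //; first by rewrite -ltnS.
  by move: sL; case: (size L).
(* This functional sums the coefficients of orders 0 to [d] in [t], that is, truncates modulo
   [t^(d+1)] and sets [t = 1]. As [deg g <= d], it recovers [g] itself. *)
have [nu nuP] := lcoef_interpolation iota (d * (d.+1 * d)).+1
  (fun i => (i < d.+1)%:R) F0.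
have gE' : g = lcoef iota (fun i => (i < d.+1)%:R) E.
  rewrite -[LHS](horner1_disp b) (horner_coef_wide _ (leq_trans (size_disp b g) gd)).
  pose M := (size E + d.+1)%N.
  rewrite (@lcoefE _ _ _ _ M) ?leq_addr //.
  rewrite (big_ord_widen M (fun i => (disp b g)`_i * 1 ^+ i)) ?leq_addl // big_mkcond.
  apply: eq_bigr => i _; rewrite expr1n mulr1; case: ifP => id.
    by rewrite rmorph1 mulr1; apply: (proj1 (tmodP _ _ _) gE).
  by rewrite rmorph0 mulr0.
exists (fun v => nu v * g.@[b]), kap, cu.
exists (fun u v i => a i * u%:R + b i - v%:R * b i).
rewrite {1}gE' nuP //; apply: eq_bigr => v _.
rewrite /E hornerZ /texp horner_sum mulrA -rmorphM mul_mpolyC; congr (_ *: _).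
apply: eq_bigr => j _; rewrite hornerZ horner_exp -mul_mpolyC.
congr (_ * _ ^+ _).
  by rewrite (rmorphV iota) ?(fact_unit natF) // (rmorph_nat iota).
rewrite LE horner_sum; apply: eq_bigr => u _; rewrite horner_sum; apply: eq_bigr => m _.
rewrite hornerZ horner_exp hornerD hornerN hornerC mul_mpolyC; congr (_ *: (_ - _) ^+ _).
exact: disp_line_horner.
Qed.

End ClosedForm.

(** * Cost classes and formulas *)


Section CostClass.
Variables (F : fieldType) (n : nat).
Local Notation A := {mpoly F[n]}.

(* [K p s D]: the polynomial [p] is computable with [s] wires in depth [D]. *)
Record cost_class (K : A -> nat -> nat -> Prop) : Prop := CostClass {
  cost_mono : forall p s s' D D', K p s D -> (s <= s')%N -> (D <= D')%N -> K p s' D';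
  cost_const : forall c, K c%:MP 0 0;
  cost_add : forall (l : seq (F * A)) s D, (forall x, x \in l -> K x.2 s D) ->
    K (\sum_(x <- l) (x.1 *: x.2)) (size l * s.+1)%N D.+1;
  cost_mul : forall (l : seq (F * A)) s D, (forall x, x \in l -> K x.2 s D) ->
    K (\prod_(x <- l) (x.1 *: x.2)) (size l * s.+1)%N D.+1 }.

Variables (K : A -> nat -> nat -> Prop) (KP : cost_class K).

Lemma cost_sum (I : finType) (c : I -> F) (G : I -> A) s D :
  (forall i, K (G i) s D) -> K (\sum_i c i *: G i) (#|I| * s.+1)%N D.+1.
Proof.
move=> KG; have := @cost_add _ KP [seq (c i, G i) | i <- index_enum I] s D.
rewrite size_map big_map /=.
have -> : size (index_enum I) = #|I| by rewrite cardT enumT.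
by apply=> x /mapP[i _ ->] /=.
Qed.

Lemma cost_exp p j s D : K p s D -> K (p ^+ j) (j * s.+1)%N D.+1.
Proof.
move=> Kp; have := @cost_mul _ KP (nseq j (1, p)) s D.
rewrite size_nseq big_nseq /= scale1r; have -> : iter j ( *%R p) 1 = p ^+ j.
  by elim: j => [|j IH] //=; rewrite IH exprS.
by apply=> x /nseqP[-> _].
Qed.

Lemma cost_subC p c s D : K p s D -> K (p - c%:MP) (2 * s.+1)%N D.+1.
Proof.
move=> Kp; have := @cost_add _ KP [:: (1, p); (-1, c%:MP)] s D.
rewrite !big_cons big_nil /= scale1r scaleN1r addr0; apply=> x.
rewrite !inE => /orP[] /eqP -> //=; exact: cost_mono (cost_const KP c) _ _.
Qed.

(** Read from the inside: shift by a constant, power, sum for the logarithm, power, sum for the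
    exponential. Successors are spelled [+ 1] to match the polynomial bound over the rationals. *)
Definition factor_size (S d : nat) : nat :=
  ((d * ((d + 1) * d) + 1) * (d + 1) *
    ((d + 1) * (((d + 1) * d + 1) * (d + 1) *
      ((d + 1) * (2 * (S + 1) + 1) + 1) + 1) + 1))%N.

(** The closed formula adds five layers to the affine substitutions: three sums and two powers. *)
Lemma cost_factor (d S D : nat) (f g : A) :
    [pchar F] =i pred0 -> f != 0 -> msize f = d.+1 -> mdivides g f ->
    (forall v c, K (affine_sub v c f) S D) ->
  K g (factor_size S d) (D + 5)%N.
Proof.
move=> F0 f0 fd gf Kf; have [nu [mu [c [e ->]]]] := factor_formula F0 f0 fd gf.
have K1 u v : K (affine_sub v%:R (e u v) f - (c u)%:MP) (2 * S.+1)%N D.+1.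
  exact/cost_subC/Kf.
have K2 u v (m : 'I_d.+1) :
    K ((affine_sub v%:R (e u v) f - (c u)%:MP) ^+ m.+1) (d.+1 * (2 * S.+1).+1)%N D.+2.
  by apply: (cost_mono KP (cost_exp m.+1 (K1 u v))); rewrite // leq_mul2r ltn_ord orbT.
pose G v := \sum_(u < (d.+1 * d).+1) \sum_(m < d.+1)
      mu u m *: (affine_sub v%:R (e u v) f - (c u)%:MP) ^+ m.+1.
have K3 v : K (G v)
    ((d.+1 * d).+1 * d.+1 * (d.+1 * (2 * S.+1).+1).+1)%N D.+3.
  rewrite /G pair_bigA /=.
  have := @cost_sum ('I_(d.+1 * d).+1 * 'I_d.+1)%type (fun i => mu i.1 i.2)
     (fun i => (affine_sub v%:R (e i.1 v) f - (c i.1)%:MP) ^+ i.2.+1) _ _ (fun i => K2 i.1 v i.2).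
  by rewrite card_prod !card_ord.
(* Combining the scalars lets the interpolation in [t] and the exponential series share one addition
   gate. *)
under eq_bigr => v _ do rewrite scaler_sumr.
under eq_bigr => v _ do under eq_bigr => j _ do rewrite scalerA.
rewrite pair_bigA /=.
move: K3; set S3 := (_ * _)%N => K3.
have K4 v (j : 'I_d.+1) : K (G v ^+ j) (d.+1 * S3.+1)%N D.+4.
  by apply: (cost_mono KP (cost_exp j (K3 v))); rewrite // leq_mul2r ltnW ?orbT.
have := @cost_sum ('I_(d * (d.+1 * d)).+1 * 'I_d.+1)%type
   (fun i => nu i.1 * (i.2`!)%:R^-1) (fun i => G i.1 ^+ i.2) _ _ (fun i => K4 i.1 i.2).
rewrite card_prod !card_ord => /(cost_mono KP); apply; last by rewrite addnC.
by rewrite /factor_size /S3 !addn1.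
Qed.

End CostClass.

Section Formulas.
Variables (F : fieldType) (n : nat).
Local Notation A := {mpoly F[n]}.
Implicit Types (t : formula F n) (l : seq (F * formula F n)).

(** Subformulas sit inside lists, so the induction hypotheses range over list members; [List.In]
    asks for no decidable equality on formulas. *)
Lemma formula_rect_In (P : formula F n -> Prop) :
    (forall i, P (FVar F i)) -> (forall c, P (FConst n c)) ->
    (forall l, (forall x, List.In x l -> P x.2) -> P (FAdd l)) ->
    (forall l, (forall x, List.In x l -> P x.2) -> P (FMul l)) ->
  forall t, P t.
Proof.
move=> PV PC PA PM; fix IH 1; case=> [i|c|l|l].
- exact: PV.
- exact: PC.
- by apply: PA; elim: l => [|[a t] l IHl] x; [by case | case=> [<-|/IHl]; [exact: IH|]].
- by apply: PM; elim: l => [|[a t] l IHl] x; [by case | case=> [<-|/IHl]; [exact: IH|]].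
Qed.

Lemma formula_evalA l : formula_eval (FAdd l) = \sum_(x <- l) (x.1 *: formula_eval x.2).
Proof. by elim: l => [|[a t] l /= IH]; rewrite ?big_nil ?big_cons //= IH. Qed.

Lemma formula_evalM l : formula_eval (FMul l) = \prod_(x <- l) (x.1 *: formula_eval x.2).
Proof. by elim: l => [|[a t] l /= IH]; rewrite ?big_nil ?big_cons //= IH. Qed.

Lemma formula_sizeA l : formula_size (FAdd l) = (\sum_(x <- l) (formula_size x.2).+1)%N.
Proof. by elim: l => [|[a t] l /= IH]; rewrite ?big_nil ?big_cons //= IH. Qed.

Lemma formula_sizeM l : formula_size (FMul l) = (\sum_(x <- l) (formula_size x.2).+1)%N.
Proof. by elim: l => [|[a t] l /= IH]; rewrite ?big_nil ?big_cons //= IH. Qed.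

Definition formula_cost (p : A) (s D : nat) : Prop :=
  exists2 t : formula F n, formula_eval t = p & (formula_size t <= s)%N.

Lemma formula_list (l : seq (F * A)) s D : (forall x, x \in l -> formula_cost x.2 s D) ->
  exists l' : seq (F * formula F n),
    [seq (x.1, formula_eval x.2) | x <- l'] = l /\
    (\sum_(x <- l') (formula_size x.2).+1 <= size l * s.+1)%N.
Proof.
elim: l => [|[a p] l IH] lP; first by exists [::]; rewrite big_nil.
have [|l' [lE ls]] := IH; first by move=> x xl; apply: lP; rewrite inE xl orbT.
have [t /= tE ts] := lP (a, p) (mem_head _ _).
exists ((a, t) :: l'); rewrite /= lE tE; split=> //.
by rewrite big_cons mulSn leq_add.
Qed.

Lemma formula_cost_class : cost_class formula_cost.
Proof.
split.
- by move=> p s s' D D' [t tE ts] ss' _; exists t; rewrite ?(leq_trans ts).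
- by move=> c; exists (FConst n c).
- move=> l s D /formula_list[l' [lE ls]]; exists (FAdd l'); last by rewrite formula_sizeA.
  by rewrite formula_evalA -lE big_map.
- move=> l s D /formula_list[l' [lE ls]]; exists (FMul l'); last by rewrite formula_sizeM.
  by rewrite formula_evalM -lE big_map.
Qed.

(** Every variable leaf becomes a sum gate with two wires. The [+ 2] covers a bare leaf, and one
    incoming wire restores the factor: [(3s + 2) + 1 = 3(s + 1)]. *)
Lemma formula_affine v c t :
  exists2 t', formula_eval t' = affine_sub v c (formula_eval t) &
    (formula_size t' <= 3 * formula_size t + 2)%N.
Proof.
have lists l : (forall x, List.In x l ->
      exists2 t', formula_eval t' = affine_sub v c (formula_eval x.2) &
      (formula_size t' <= 3 * formula_size x.2 + 2)%N) ->
    exists l' : seq (F * formula F n),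
      [seq (x.1, formula_eval x.2) | x <- l'] =
      [seq (x.1, affine_sub v c (formula_eval x.2)) | x <- l] /\
      (\sum_(x <- l') (formula_size x.2).+1 <=
        3 * \sum_(x <- l) (formula_size x.2).+1)%N.
  elim: l => [|[a t'] l IH] lP; first by exists [::]; rewrite !big_nil.
  have [|l' [lE ls]] := IH; first by move=> x xl; apply: lP; right.
  have [t1 /= tE ts] := lP (a, t') (or_introl erefl).
  exists ((a, t1) :: l'); rewrite /= lE tE; split=> //.
  rewrite !big_cons mulnDr /=; lia.
elim/formula_rect_In: t => [i|x|l /lists[l' [lE ls]]|l /lists[l' [lE ls]]].
- exists (FAdd [:: (v, FVar F i); (1, FConst n (c i))]) => //=.
  by rewrite addr0 scale1r affine_subX.
- by exists (FConst n x) => //=; rewrite affine_subC.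
- exists (FAdd l'); last by rewrite !formula_sizeA (leq_trans ls) ?leq_addr.
  rewrite !formula_evalA rmorph_sum /=.
  transitivity (\sum_(x <- [seq (x.1, formula_eval x.2) | x <- l']) (x.1 *: x.2)).
    by rewrite big_map.
  rewrite lE big_map; apply: eq_bigr => x _ /=.
  by rewrite -!mul_mpolyC rmorphM /= affine_subC.
- exists (FMul l'); last by rewrite !formula_sizeM (leq_trans ls) ?leq_addr.
  rewrite !formula_evalM rmorph_prod /=.
  transitivity (\prod_(x <- [seq (x.1, formula_eval x.2) | x <- l']) (x.1 *: x.2)).
    by rewrite big_map.
  rewrite lE big_map; apply: eq_bigr => x _ /=.
  by rewrite -!mul_mpolyC rmorphM /= affine_subC.
Qed.

End Formulas.

(** * Circuits *)


Section Circuits.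
Variables (F : fieldType) (n : nat).
Local Notation A := {mpoly F[n]}.
Implicit Types (L : seq (A * nat)) (C : circuit F n) (l : seq (F * (A * nat))).

(* The values, with upper bounds on their depths, computed by a circuit with
   [s] wires.  Wires refer to their source by its value instead of its index,
   so that concatenating two circuits requires no renumbering. *)
Inductive slp : seq (A * nat) -> nat -> Prop :=
| slp_nil : slp [::] 0
| slp_var L s i D : slp L s -> slp (rcons L ('X_i, D)) s
| slp_const L s c D : slp L s -> slp (rcons L (c%:MP, D)) s
| slp_add L s l D : slp L s -> l != [::] ->
    (forall x, x \in l -> x.2 \in L /\ (x.2.2 < D)%N) ->
    slp (rcons L (\sum_(x <- l) (x.1 *: x.2.1), D)) (s + size l)
| slp_mul L s l D : slp L s -> l != [::] ->
    (forall x, x \in l -> x.2 \in L /\ (x.2.2 < D)%N) ->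
    slp (rcons L (\prod_(x <- l) (x.1 *: x.2.1), D)) (s + size l).

Lemma slp_cat L1 s1 L2 s2 : slp L1 s1 -> slp L2 s2 -> slp (L1 ++ L2) (s1 + s2).
Proof.
move=> L1P; elim=> [|L s i D _ IH|L s c D _ IH|L s l D _ IH l0 lP|L s l D _ IH l0 lP].
- by rewrite cats0 addn0.
- by rewrite -rcons_cat; apply: slp_var.
- by rewrite -rcons_cat; apply: slp_const.
- rewrite -rcons_cat addnA; apply: slp_add => // x /lP[xL xD].
  by rewrite mem_cat xL orbT.
- rewrite -rcons_cat addnA; apply: slp_mul => // x /lP[xL xD].
  by rewrite mem_cat xL orbT.
Qed.

(** Recorded depths are only upper bounds, so all may be raised together; this yields monotonicity
    of the cost in the depth. *)
Lemma slp_shift k L s : slp L s -> slp [seq (x.1, x.2 + k)%N | x <- L] s.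
Proof.
have shl L' l D : (forall x, x \in l -> x.2 \in L' /\ (x.2.2 < D)%N) ->
    forall x, x \in [seq (y.1, (y.2.1, y.2.2 + k)%N) | y <- l] ->
    x.2 \in [seq (x.1, x.2 + k)%N | x <- L'] /\ (x.2.2 < D + k)%N.
  move=> lP _ /mapP[y /lP[yL yD] ->]; split; last by rewrite ltn_add2r.
  exact: (map_f (fun x => (x.1, x.2 + k)%N) yL).
elim=> [|{}L {}s i D _ IH|{}L {}s c D _ IH|{}L {}s l D _ IH l0 lP|{}L {}s l D _ IH l0 lP].
- exact: slp_nil.
- by rewrite map_rcons; apply: slp_var.
- by rewrite map_rcons; apply: slp_const.
- have := @slp_add _ _ [seq (y.1, (y.2.1, y.2.2 + k)%N) | y <- l] (D + k)%N IH.
  rewrite size_map big_map map_rcons; apply; last exact: shl.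
  by move: l0; case: (l).
- have := @slp_mul _ _ [seq (y.1, (y.2.1, y.2.2 + k)%N) | y <- l] (D + k)%N IH.
  rewrite size_map big_map map_rcons; apply; last exact: shl.
  by move: l0; case: (l).
Qed.

(** The output of a circuit is its last gate, so everything after the wanted value is cut off. *)
Lemma slp_last L s x : slp L s -> x \in L ->
  exists L' s', slp (rcons L' x) s' /\ (s' <= s)%N.
Proof.
have step (L0 : seq (A * nat)) y s0 s1 : slp (rcons L0 y) s1 -> (s0 <= s1)%N ->
    (x \in L0 -> exists L' s', slp (rcons L' x) s' /\ (s' <= s0)%N) ->
    x \in rcons L0 y -> exists L' s', slp (rcons L' x) s' /\ (s' <= s1)%N.
  move=> L0P s01 IH; rewrite mem_rcons inE => /orP[/eqP ->|/IH[L' [s' [L'P s's]]]].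
    by exists L0, s1.
  by exists L', s'; split=> //; apply: leq_trans s01.
elim=> [//|{}L {}s i D LP IH|{}L {}s c D LP IH|{}L {}s l D LP IH l0 lP|{}L {}s l D LP IH l0 lP].
- by apply: step IH => //; apply: slp_var.
- by apply: step IH => //; apply: slp_const.
- by apply: step IH; [apply: slp_add | apply: leq_addr].
- by apply: step IH; [apply: slp_mul | apply: leq_addr].
Qed.

Definition gates_wf C := all (fun kg => gate_wf kg.1 kg.2) (zip (iota 0 (size C)) C).

Lemma gates_wf_rcons C g : gates_wf (rcons C g) = gates_wf C && gate_wf (size C) g.
Proof.
rewrite /gates_wf size_rcons -addn1 iotaD add0n /= cats1 zip_rcons ?size_iota //.
by rewrite all_rcons andbC.
Qed.

Lemma circuit_vals_rcons C g :
  circuit_vals (rcons C g) = rcons (circuit_vals C) (eval_gate (circuit_vals C) g).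
Proof. by rewrite /circuit_vals foldl_rcons. Qed.

Lemma circuit_depths_rcons C g :
  circuit_depths (rcons C g) = rcons (circuit_depths C) (depth_gate (circuit_depths C) g).
Proof. by rewrite /circuit_depths foldl_rcons. Qed.

Lemma circuit_size_rcons C g :
  circuit_size (rcons C g) = (circuit_size C + size (gate_inputs g))%N.
Proof. by rewrite /circuit_size map_rcons sumn_rcons. Qed.

Lemma size_circuit_vals C : size (circuit_vals C) = size C.
Proof.
elim/last_ind: C => [//|C g IH].
by rewrite circuit_vals_rcons !size_rcons IH.
Qed.

Lemma size_circuit_depths C : size (circuit_depths C) = size C.
Proof.
elim/last_ind: C => [//|C g IH].
by rewrite circuit_depths_rcons !size_rcons IH.
Qed.

(** Each wire is sent to the first position holding its value and depth bound; repeated entries are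
    harmless since they agree in both. *)
Lemma slp_circuit L s : slp L s -> exists C,
  [/\ gates_wf C, circuit_vals C = unzip1 L, circuit_size C = s &
      forall k, (nth 0%N (circuit_depths C) k <= nth 0%N (unzip2 L) k)%N].
Proof.
have leaf L0 C g p D : [/\ gates_wf C, circuit_vals C = unzip1 L0 &
    forall k, (nth 0%N (circuit_depths C) k <= nth 0%N (unzip2 L0) k)%N] ->
    gate_wf (size C) g -> eval_gate (circuit_vals C) g = p ->
    (depth_gate (circuit_depths C) g <= D)%N ->
   [/\ gates_wf (rcons C g), circuit_vals (rcons C g) = unzip1 (rcons L0 (p, D)) &
    forall k, (nth 0%N (circuit_depths (rcons C g)) k <=
       nth 0%N (unzip2 (rcons L0 (p, D))) k)%N].
  move=> [Cwf CL Cd] gwf gp gD; split.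
  - by rewrite gates_wf_rcons Cwf.
  - by rewrite circuit_vals_rcons gp CL /unzip1 map_rcons.
  move=> k; rewrite circuit_depths_rcons /unzip2 map_rcons /= !nth_rcons.
  rewrite size_circuit_depths -size_circuit_vals CL !size_map.
  by case: ltnP => // _; case: eqP.
have wires L0 C l D : [/\ gates_wf C, circuit_vals C = unzip1 L0 &
    forall k, (nth 0%N (circuit_depths C) k <= nth 0%N (unzip2 L0) k)%N] ->
    (forall x, x \in l -> x.2 \in L0 /\ (x.2.2 < D)%N) ->
    let l' := [seq (x.1, index x.2 L0) | x <- l] in
    [/\ all (fun p => p.2 < size C)%N l',
        [seq (p.1, nth 0 (circuit_vals C) p.2) | p <- l'] = [seq (x.1, x.2.1) | x <- l] &
        (l != [::] -> (\max_(p <- l') nth 0%N (circuit_depths C) p.2).+1 <= D)%N].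
  move=> [Cwf CL Cd] lP l'; have sC : size C = size L0.
    by rewrite -size_circuit_vals CL size_map.
  split.
  - by apply/allP => _ /mapP[x /lP[xL _] ->] /=; rewrite sC index_mem.
  - rewrite -map_comp; apply/eq_in_map => x /lP[xL _] /=.
    by rewrite CL (nth_map (0, 0%N)) ?index_mem // nth_index.
  have lt x : x \in l -> (nth 0%N (circuit_depths C) (index x.2 L0) < D)%N.
    move=> /lP[xL xD]; apply: leq_ltn_trans (Cd _) _.
    by rewrite (nth_map (0, 0%N)) ?index_mem // nth_index.
  move=> l0; have D0 : (0 < D)%N.
    by move: l0 lt; case: (l) => // x l1 _ /(_ x (mem_head _ _)); case: (D).
  rewrite -(prednK D0) ltnS big_map; apply/bigmax_leqP_seq => x xl _.
  by rewrite -ltnS prednK // lt.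
elim=> [|{}L {}s i D LP [C [C1 C2 C3 C4]]|{}L {}s c D LP [C [C1 C2 C3 C4]]
  |{}L {}s l D LP [C [C1 C2 C3 C4]] l0 lP|{}L {}s l D LP [C [C1 C2 C3 C4]] l0 lP].
- by exists [::]; split=> // k; rewrite !nth_nil.
- have [//|//|//|//|D1 D2 D3] := leaf L C (GVar F i) 'X_i D.
  by exists (rcons C (GVar F i)); split=> //; rewrite circuit_size_rcons C3 addn0.
- have [//|//|//|//|D1 D2 D3] := leaf L C (GConst n c) c%:MP D.
  by exists (rcons C (GConst n c)); split=> //; rewrite circuit_size_rcons C3 addn0.
- have [W1 W2 W3] := wires L C l D (And3 C1 C2 C4) lP.
  set l' := [seq (x.1, index x.2 L) | x <- l] in W1 W2 W3; have l'0 : l' != [::] by move: l0; rewrite /l'; case: (l).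
  have [//||||D1 D2 D3] := leaf L C (GAdd n l') (\sum_(x <- l) (x.1 *: x.2.1)) D.
  + by rewrite /= l'0.
  + rewrite /=; transitivity (\sum_(p <- [seq (p.1, nth 0 (circuit_vals C) p.2) | p <- l'])
       (p.1 *: p.2)); first by rewrite [in RHS]big_map.
    by rewrite W2 big_map.
  + exact: W3.
  exists (rcons C (GAdd n l')); split=> //.
  by rewrite circuit_size_rcons C3 /= size_map.
- have [W1 W2 W3] := wires L C l D (And3 C1 C2 C4) lP.
  set l' := [seq (x.1, index x.2 L) | x <- l] in W1 W2 W3; have l'0 : l' != [::] by move: l0; rewrite /l'; case: (l).
  have [//||||D1 D2 D3] := leaf L C (GMul n l') (\prod_(x <- l) (x.1 *: x.2.1)) D.
  + by rewrite /= l'0.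
  + rewrite /=; transitivity (\prod_(p <- [seq (p.1, nth 0 (circuit_vals C) p.2) | p <- l'])
       (p.1 *: p.2)); first by rewrite [in RHS]big_map.
    by rewrite W2 big_map.
  + exact: W3.
  exists (rcons C (GMul n l')); split=> //.
  by rewrite circuit_size_rcons C3 /= size_map.
Qed.

Definition circuit_cost (p : A) (s D : nat) : Prop :=
  exists L s', [/\ slp L s', (s' <= s)%N & (p, D) \in L].

Lemma circuit_cost_list (l : seq (F * A)) s D :
  (forall x, x \in l -> circuit_cost x.2 s D) ->
  exists L s', [/\ slp L s', (s' <= size l * s)%N & forall x, x \in l -> (x.2, D) \in L].
Proof.
elim: l => [|a l IH] lP; first by exists [::], 0; split=> //; apply: slp_nil.
have [|L [s' [LP s's lL]]] := IH; first by move=> x xl; apply: lP; rewrite inE xl orbT.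
have [L1 [s1 [L1P s1s aL]]] := lP a (mem_head _ _).
exists (L1 ++ L), (s1 + s')%N; split; first exact: slp_cat.
  by rewrite mulSn leq_add.
by move=> x; rewrite inE mem_cat => /orP[/eqP ->|/lL ->]; rewrite ?aL ?orbT.
Qed.

Lemma circuit_cost_class : cost_class circuit_cost.
Proof.
have const c D : circuit_cost c%:MP 0 D.
  exists [:: (c%:MP, D)], 0; split=> //; last by rewrite inE.
  exact: (slp_const c D slp_nil).
have mono p s s' D D' : circuit_cost p s D -> (s <= s')%N -> (D <= D')%N ->
    circuit_cost p s' D'.
  move=> [L [s1 [LP s1s pL]]] ss' DD'.
  exists [seq (x.1, x.2 + (D' - D))%N | x <- L], s1; split.
  - exact: slp_shift.
  - exact: leq_trans ss'.
  have := map_f (fun x : A * nat => (x.1, x.2 + (D' - D))%N) pL.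
  by rewrite /= subnKC.
have wiresP (l : seq (F * A)) (L : seq (A * nat)) D : (forall x, x \in l -> (x.2, D) \in L) ->
    forall x, x \in [seq (y.1, (y.2, D)) | y <- l] -> x.2 \in L /\ (x.2.2 < D.+1)%N.
  by move=> lL _ /mapP[y yl ->]; split; [apply: lL | apply: ltnSn].
split=> // l s D lP.
(* Gates without inputs are not well formed, so an empty sum is replaced by a constant leaf, and
   likewise an empty product below. *)
- have [->|l0] := eqVneq l [::]; first by rewrite big_nil -mpolyC0; apply: mono (const 0 0) _ _.
  have [L [s' [LP s's lL]]] := circuit_cost_list lP.
  have := @slp_add _ _ [seq (y.1, (y.2, D)) | y <- l] D.+1 LP.
  rewrite size_map big_map => S; exists (rcons L (\sum_(x <- l) (x.1 *: x.2), D.+1)).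
  exists (s' + size l)%N; split.
  + by apply: S; [move: l0; case: (l) | apply: wiresP].
  + by rewrite mulnS addnC leq_add2l.
  + by rewrite mem_rcons mem_head.
- have [->|l0] := eqVneq l [::]; first by rewrite big_nil -mpolyC1; apply: mono (const 1 0) _ _.
  have [L [s' [LP s's lL]]] := circuit_cost_list lP.
  have := @slp_mul _ _ [seq (y.1, (y.2, D)) | y <- l] D.+1 LP.
  rewrite size_map big_map => S; exists (rcons L (\prod_(x <- l) (x.1 *: x.2), D.+1)).
  exists (s' + size l)%N; split.
  + by apply: S; [move: l0; case: (l) | apply: wiresP].
  + by rewrite mulnS addnC leq_add2l.
  + by rewrite mem_rcons mem_head.
Qed.

Lemma circuit_cost_computes p s D : circuit_cost p s D ->
  exists C, [/\ computes_circuit C p, (circuit_size C <= s)%N & (circuit_depth C <= D)%N].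
Proof.
move=> [L0 [s0 [/slp_last LP s0s /LP[L [s' [/slp_circuit[C [C1 C2 C3 C4]] s's0]]]]]].
have sC : size C = (size L).+1 by rewrite -size_circuit_vals C2 size_map size_rcons.
exists C; split; [split|..].
- by rewrite /circuit_wf -/(gates_wf C) C1 sC.
- by rewrite /circuit_output C2 /unzip1 map_rcons last_rcons.
- by rewrite C3 (leq_trans s's0).
rewrite /circuit_depth -nth_last (leq_trans (C4 _)) //.
rewrite size_circuit_depths sC /unzip2 map_rcons nth_rcons size_map ltnn eqxx //.
Qed.

Lemma slp_affine_vars v c (r : seq 'I_n) : exists2 L, slp L (2 * size r) &
  forall i, i \in r -> (v *: 'X_i + (c i)%:MP, 1%N) \in L.
Proof.
elim: r => [|i r [L LP rL]]; first by exists [::] => //; apply: slp_nil.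
pose l : seq (F * (A * nat)) := [:: (v, ('X_i, 0%N)); (1, ((c i)%:MP, 0%N))].
have := @slp_add _ _ l 1 (slp_const (c i) 0 (slp_var i 0 LP)).
rewrite !big_cons big_nil /= addr0 scale1r => S.
exists (rcons (rcons (rcons L ('X_i, 0%N)) ((c i)%:MP, 0%N)) (v *: 'X_i + (c i)%:MP, 1%N)).
  rewrite mulnS addnC; apply: S => // x; rewrite !inE => /orP[] /eqP -> /=.
    by split=> //; rewrite mem_rcons inE mem_rcons mem_head orbT.
  by split=> //; rewrite mem_rcons mem_head.
move=> j; rewrite inE => /orP[/eqP ->|/rL jL]; first by rewrite mem_rcons mem_head.
by rewrite mem_rcons inE mem_rcons inE mem_rcons inE jL !orbT.
Qed.

(** The [n] affine forms are built once, with two wires each, and shared by all gates that read a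
    variable; this costs one extra level of depth. *)
Lemma circuit_affine v c C : gates_wf C ->
  exists L, slp L (2 * n + circuit_size C) /\
    forall k, (k < size C)%N ->
      (affine_sub v c (nth 0 (circuit_vals C) k), (nth 0%N (circuit_depths C) k).+1) \in L.
Proof.
move=> Cwf.
(* The induction also keeps the affine forms available, so that a variable gate met later can refer
   to them. *)
suff [L [LP _ CL]] : exists L, [/\ slp L (2 * n + circuit_size C),
    forall i, (v *: 'X_i + (c i)%:MP, 1%N) \in L & forall k, (k < size C)%N ->
      (affine_sub v c (nth 0 (circuit_vals C) k), (nth 0%N (circuit_depths C) k).+1) \in L].
  by exists L.
elim/last_ind: C Cwf => [_|C g IH].
  have [L LP rL] := slp_affine_vars v c (enum 'I_n).
  exists L; split=> //; first by rewrite /circuit_size addn0 -[n in (2 * n)%N]size_enum_ord.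
  by move=> i; apply: rL; rewrite mem_enum.
rewrite gates_wf_rcons => /andP[/IH[L [LP XL CL]] gwf].
suff [L' [LP' sub gL]] : exists L',
  [/\ slp L' (2 * n + circuit_size (rcons C g)), {subset L <= L'} &
    (affine_sub v c (eval_gate (circuit_vals C) g),
      (depth_gate (circuit_depths C) g).+1) \in L'].
  exists L'; split=> // [i|k]; first exact/sub/XL.
  rewrite size_rcons ltnS circuit_vals_rcons circuit_depths_rcons !nth_rcons.
  rewrite size_circuit_vals size_circuit_depths; case: ltngtP => // kC _.
  exact/sub/CL.
have sub x : {subset L <= rcons L x} by move=> y yL; rewrite mem_rcons inE yL orbT.
pose wire (p : F * nat) := (p.1, (affine_sub v c (nth 0 (circuit_vals C) p.2),
  (nth 0%N (circuit_depths C) p.2).+1)).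
have wire0 (l : seq (F * nat)) : l != [::] -> map wire l != [::] by case: l.
have wiresP (l : seq (F * nat)) : all (fun p => p.2 < size C)%N l ->
    forall x, x \in map wire l ->
    x.2 \in L /\ (x.2.2 < (\max_(p <- l) nth 0%N (circuit_depths C) p.2).+2)%N.
  move=> /allP lC _ /mapP[p pl ->]; split; first exact/CL/lC.
  by rewrite /= !ltnS; apply: leq_bigmax_seq pl isT.
case: g gwf => [i|x|l|l] gwf; rewrite circuit_size_rcons.
- exists L; rewrite addn0; split=> //=.
  by rewrite affine_subX.
(* The leaf is recorded at depth 1, the depth 0 of the original leaf plus the common shift. *)
- eexists; rewrite addn0; split; [exact: (slp_const x 1 LP) | exact: sub |].
  by rewrite /= affine_subC mem_rcons mem_head.
- case/andP: gwf => l0 lC; have := slp_add LP (wire0 l l0) (wiresP l lC).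
  rewrite size_map -addnA => S; eexists; split; [exact: S | exact: sub |].
  rewrite mem_rcons inE; apply/orP; left; apply/eqP; congr (_, _).
  rewrite big_map /= rmorph_sum; apply: eq_bigr => p _.
  by rewrite -!mul_mpolyC rmorphM /= affine_subC.
- case/andP: gwf => l0 lC; have := slp_mul LP (wire0 l l0) (wiresP l lC).
  rewrite size_map -addnA => S; eexists; split; [exact: S | exact: sub |].
  rewrite mem_rcons inE; apply/orP; left; apply/eqP; congr (_, _).
  rewrite big_map /= rmorph_prod; apply: eq_bigr => p _.
  by rewrite -!mul_mpolyC rmorphM /= affine_subC.
Qed.

Lemma circuit_cost_affine v c C f : computes_circuit C f ->
  circuit_cost (affine_sub v c f) (2 * n + circuit_size C) (circuit_depth C).+1.
Proof.
move=> [/andP[C0 Cwf] <-]; have [L [LP CL]] := circuit_affine v c Cwf.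
exists L, (2 * n + circuit_size C)%N; split=> //.
have := CL (size C).-1; rewrite prednK // leqnn => /(_ isT).
rewrite /circuit_output /circuit_depth -!nth_last.
by rewrite size_circuit_vals size_circuit_depths.
Qed.

End Circuits.

(** * The polynomial size bound and the theorem *)

Definition factor_size_mpoly : {mpoly rat[3]} :=
  (* [3s + 2n + 2] dominates both substitution costs, [2n + s] for circuits and [3s + 2] for
     formulas. *)
  let S := 3 * 'X_(inord 0) + 2 * 'X_(inord 2) + 2 in let d := 'X_(inord 1) in
  (d * ((d + 1) * d) + 1) * (d + 1) *
    ((d + 1) * (((d + 1) * d + 1) * (d + 1) *
      ((d + 1) * (2 * (S + 1) + 1) + 1) + 1) + 1).

Lemma eval3_factor_size s d n :
  eval3 factor_size_mpoly s d n = (factor_size (3 * s + 2 * n + 2) d)%:R.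
Proof.
rewrite /eval3 /factor_size_mpoly /factor_size !(mevalD, mevalM, meval1, mevalXU).
by rewrite !inordK //= !(natrD, natrM).
Qed.

Lemma leq_factor_size S S' d : (S <= S')%N -> (factor_size S d <= factor_size S' d)%N.
Proof.
by move=> SS'; rewrite /factor_size !(leq_mul2l, leq_add2r) SS' !orbT.
Qed.

Theorem theorem1p1 (F : fieldType) (charF0 : [pchar F] =i pred0) :
  exists (q : {mpoly rat[3]}) (c : nat),
  forall (n d : nat) (f g : {mpoly F[n]}),
    f != 0 -> msize f = d.+1 -> mdivides g f ->
    (forall (s Delta : nat) (C : circuit F n),
        computes_circuit C f -> circuit_size C = s -> circuit_depth C = Delta ->
        exists C' : circuit F n,
          [/\ computes_circuit C' g,
              (circuit_size C')%:R <= eval3 q s d n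
            & (circuit_depth C' <= Delta + c)%N]) /\
    (forall (s : nat) (t : formula F n),
        formula_eval t = f -> formula_size t = s ->
        exists t' : formula F n,
          formula_eval t' = g /\ (formula_size t')%:R <= eval3 q s d n).
Proof.
(* One level for the affine substitution and five for the closed formula. *)
exists factor_size_mpoly, 6 => n d f g f0 fd gf; split.
- move=> s Delta C Cf Cs CD.
  have Kf v c : circuit_cost (affine_sub v c f) (2 * n + s) Delta.+1.
    by rewrite -Cs -CD; apply: circuit_cost_affine.
  have := cost_factor (@circuit_cost_class F n) charF0 f0 fd gf Kf.
  move=> /circuit_cost_computes[C' [C'g C's C'D]]; exists C'; split=> //.
    rewrite eval3_factor_size ler_nat (leq_trans C's) // leq_factor_size //; lia.
  by rewrite (leq_trans C'D) // addSnnS.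
- move=> s t tf ts.
  have Kf v c : formula_cost (affine_sub v c f) (3 * s + 2) 0.
    by rewrite -tf -ts; have [t' t'E t's] := formula_affine v c t; exists t'.
  have := cost_factor (@formula_cost_class F n) charF0 f0 fd gf Kf.
  move=> [t' t'g t's]; exists t'; split=> //.
  rewrite eval3_factor_size ler_nat (leq_trans t's) // leq_factor_size //; lia.
Qed.
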